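(* Let $\alpha,L>0$, let $w_0\in\mathcal{Z}$, let $g:\mathcal{Z}\to\mathcal{Z}^*$ be a (continuous) monotone operator and let $\tilde g_{w_0}$ be a $(w_0,L)$-centered stochastic gradient estimator for $g$. Let $\eta=\frac{\alpha}{10L^2}$ and let $T$ be an integer with $T\ge\frac{4}{\eta\alpha}=\frac{40L^2}{\alpha^2}$. Then the iterates $$w_t=\operatorname*{arg\,min}_{w\in\mathcal{Z}}\Big\{\langle\tilde g_{w_0}(w_{t-1}),w\rangle+\tfrac{\alpha}{2}V_{w_0}(w)+\tfrac1\eta V_{w_{t-1}}(w)\Big\},\qquad t=1,\dots,T,$$ satisfy $$\mathbb{E}\max_{u\in\mathcal{Z}}\left[\frac1T\sum_{t=1}^T\langle g(w_t),w_t-u\rangle-\alpha V_{w_0}(u)\right]\le0.$$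
   Context: Setup: $\mathcal{Z}=\mathcal{X}\times\mathcal{Y}$ with $\mathcal{X}\subset\mathbb{R}^n$, $\mathcal{Y}\subset\mathbb{R}^m$ convex and compact; $\|\cdot\|$ is a norm, with dual norm $\|\zeta\|_*=\max_{\|z\|\le1}\langle\zeta,z\rangle$; $\mathcal{Z}^*$ is the space of linear functionals. The distance generating function $r:\mathcal{Z}\to\mathbb{R}$ is $1$-strongly convex: $r(z')\ge r(z)+\langle\nabla r(z),z'-z\rangle+\frac12\|z'-z\|^2$ for all $z,z'\in\mathcal{Z}$ (for non-differentiable $r$, $\langle\nabla r(z),w\rangle:=\sup_{\gamma\in\partial r(z)}\langle\gamma,w\rangle$), and $\max r-\min r$ is finite. The Bregman divergence is $V_z(z')=r(z')-r(z)-\langle\nabla r(z),z'-z\rangle\ge\frac12\|z'-z\|^2$; it satisfies $-\langle\nabla V_z(z'),z'-u\rangle=V_z(u)-V_{z'}(u)-V_z(z')$. $g$ is monotone if $\langle g(z')-g(z),z'-z\rangle\ge0$ for all $z,z'\in\mathcal{Z}$. A stochastic estimator $\tilde g_{z_0}:\mathcal{Z}\to\mathcal{Z}^*$ is $(z_0,L)$-centered for $g$ if for all $z\in\mathcal{Z}$: (1) $\mathbb{E}[\tilde g_{z_0}(z)]=g(z)$; (2) $\mathbb{E}\|\tilde g_{z_0}(z)-g(z_0)\|_*^2\le L^2\|z-z_0\|^2$. Each evaluation of the estimator uses fresh randomness, independent of everything before. *)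

(* Defs.v *)
From mathcomp Require Export all_boot all_order all_algebra.
From mathcomp Require Export all_classical all_reals all_analysis.

Set Implicit Arguments.
Unset Strict Implicit.
Unset Printing Implicit Defensive.

Import Order.TTheory GRing.Theory Num.Theory.
Import numFieldNormedType.Exports.
Local Open Scope classical_set_scope.
Local Open Scope ring_scope.
Local Open Scope ereal_scope.

Section euclidean.
Context {R : realType} {d : nat}.
Implicit Types (x y z u w zeta gamma : 'rV[R]_d) (Z : set 'rV[R]_d).

(* Linear functionals on R^d are represented by their coordinate vectors. *)
Definition pairing zeta z : R := (\sum_(i < d) zeta 0 i * z 0 i)%R.

Record is_norm (N : 'rV[R]_d -> R) : Prop := IsNorm {
  norm_definite : forall x, N x = 0%R -> x = 0%R ;
  norm_homogeneous : forall (a : R) x, N (a *: x)%R = (`|a| * N x)%R ;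
  norm_triangle : forall x y, (N (x + y) <= N x + N y)%R }.

Definition dual_norm (N : 'rV[R]_d -> R) zeta : R :=
  sup [set pairing zeta z | z in [set z | (N z <= 1)%R]].

Definition argmin Z (F : 'rV[R]_d -> \bar R) : set 'rV[R]_d :=
  [set w | Z w /\ forall w', Z w' -> F w <= F w'].

Section bregman.
Variables (Z : set 'rV[R]_d) (r : 'rV[R]_d -> R).

Definition subdiff z : set 'rV[R]_d :=
  [set gamma | forall z', Z z' -> (r z + pairing gamma (z' - z) <= r z')%R].

(* <nabla r(z), x>.  The value is -oo when r has no subgradient at z, as
   happens for the negative entropy on the boundary of the simplex; the
   divergence from such a z is then +oo. *)
Definition grad_pairing z x : \bar R :=
  ereal_sup [set (pairing gamma x)%:E | gamma in subdiff z].

Definition bregman z z' : \bar R :=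
  (r z')%:E - (r z)%:E - grad_pairing z (z' - z)%R.

Definition strongly_convex1 (N : 'rV[R]_d -> R) : Prop :=
  forall z z', Z z -> Z z' ->
    (r z)%:E + grad_pairing z (z' - z)%R + (2^-1 * N (z' - z) ^+ 2)%:E
      <= (r z')%:E.

(* The identity
     - <nabla V_z(z'), z' - u> = V_z(u) - V_z'(u) - V_z(z'),
   where nabla V_z(z') = nabla r(z') - nabla r(z).  Here u - z' is a direction
   pointing into Z at z', but not at z, so nabla r(z) has to be an honest
   linear functional gamma.  For differentiable r, gamma is the gradient and
   the identity is automatic; it fails at a kink of r, where
   [grad_pairing z] is only sublinear. *)
Definition three_point_identity : Prop :=
  forall z, Z z -> subdiff z !=set0 ->
  exists2 gamma, subdiff z gamma &
    forall z' u, Z z' -> Z u ->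
      grad_pairing z' (u - z')%R - (pairing gamma (u - z'))%:E
        = bregman z u - bregman z' u - bregman z z'.

(* Lower semicontinuity on the compact set Z (weaker than continuity on Z)
   makes the minima of r plus a linear functional attained. *)
Record distance_generating (N : 'rV[R]_d -> R) : Prop := DistanceGenerating {
  dgf_lsc : lower_semicontinuous (fun z => if z \in Z then (r z)%:E else +oo) ;
  dgf_bounded : exists B : R, forall z, Z z -> (`|r z| <= B)%R ;
  dgf_strongly_convex : strongly_convex1 N ;
  dgf_three_point : three_point_identity }.

End bregman.

Definition monotone_operator Z (g : 'rV[R]_d -> 'rV[R]_d) : Prop :=
  forall z z', Z z -> Z z' -> (0 <= pairing (g z' - g z) (z' - z))%R.

(* An estimator is a map gt : R^d -> S -> R^d; an evaluation at z is gt z s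
   for a fresh seed s drawn from mu. *)
Record centered_estimator (N : 'rV[R]_d -> R) Z (g : 'rV[R]_d -> 'rV[R]_d)
    (dS : measure_display) (S : measurableType dS) (mu : probability S R)
    (z0 : 'rV[R]_d) (L : R) (gt : 'rV[R]_d -> S -> 'rV[R]_d) : Prop :=
  CenteredEstimator {
  (* joint measurability, for the Borel sigma-algebra on R^d *)
  estimator_measurable : forall i : 'I_d,
    measurable_fun
      [set p : g_sigma_algebraType (@open 'rV[R]_d) * S | Z p.1]
      (fun p => gt p.1 p.2 0%R i) ;
  estimator_integrable : forall z (i : 'I_d), Z z ->
    mu.-integrable setT (fun s => (gt z s 0%R i)%:E) ;
  estimator_unbiased : forall z (i : 'I_d), Z z ->
    'E_mu[fun s => gt z s 0%R i] = (g z 0%R i)%:E ;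
  estimator_centered : forall z, Z z ->
    'E_mu[fun s => (dual_norm N (gt z s - g z0) ^+ 2)%R]
      <= (L ^+ 2 * N (z - z0)%R ^+ 2)%:E }.

End euclidean.

(* Since some of the A i may be setT, the product rule for the full family
   covers all its subfamilies. *)
Definition iid (R : realType) (dO dS : measure_display)
    (Omega : measurableType dO) (P : probability Omega R)
    (S : measurableType dS) (mu : probability S R) (I : finType)
    (xi : I -> {RV P >-> S}) : Prop :=
  (forall i (A : set S), measurable A -> P (xi i @^-1` A) = mu A) /\
  (forall A : I -> set S, (forall i, measurable (A i)) ->
     P (\bigcap_(i in setT) (xi i @^-1` A i)) = \prod_(i : I) P (xi i @^-1` A i)).

(* Main.v *)
(** Write V for the Bregman divergence, gam_t for the estimate drawn at w_t,
    and eps_t = g(w_t) - gam_t.  Optimality of w_(t+1) and Young's inequality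
    bound sum_t <gam_t, w_t - u>; the shift from w_t to w_(t+1) in the averaged
    regret only costs <g(w_T) - g(w0), w_T - u>, which is absorbed because
    |g z - g w0|_* <= L |z - w0| by Jensen's inequality.  The supremum over u
    is decoupled from the noise by ghost iterates s_t of dual averaging run
    on eps_t.  What remains is a sum of the terms
      - alpha/4 |w_t - w0|^2 + eta/2 (|gam_t - g w0|_*^2 + |eps_t|_*^2)
        + <eps_t, w_t - s_t>,
    each of nonpositive conditional expectation given the past.

    Measurability of the iterates is not a hypothesis and has to be proved:
    w_t is the image, under the Lipschitz map c |-> argmin_Z (<c, .> + r), of
    a functional whose values on the directions of Z are measurable. *)
Require Import Defs.
From mathcomp Require Import finmap ring lra measurable_realfun.

Set Implicit Arguments.
Unset Strict Implicit.
Unset Printing Implicit Defensive.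

Import Order.TTheory GRing.Theory Num.Theory.
Import numFieldNormedType.Exports.
Local Open Scope classical_set_scope.
Local Open Scope ring_scope.

(** * Norms and dual norms on row vectors *)

Section pairing_lemmas.
Context {R : realType} {d : nat}.
Implicit Types x y z zeta xi : 'rV[R]_d.

Lemma pairingDl zeta xi z : pairing (zeta + xi) z = pairing zeta z + pairing xi z.
Proof. by rewrite /pairing -big_split; apply: eq_bigr => i _; rewrite mxE mulrDl. Qed.

Lemma pairingZl (a : R) zeta z : pairing (a *: zeta) z = a * pairing zeta z.
Proof. by rewrite /pairing mulr_sumr; apply: eq_bigr => i _; rewrite mxE mulrA. Qed.

Lemma pairingNl zeta z : pairing (- zeta) z = - pairing zeta z.
Proof. by rewrite -scaleN1r pairingZl mulN1r. Qed.

Lemma pairingBl zeta xi z : pairing (zeta - xi) z = pairing zeta z - pairing xi z.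
Proof. by rewrite pairingDl pairingNl. Qed.

Lemma pairingC zeta z : pairing zeta z = pairing z zeta.
Proof. by apply: eq_bigr => i _; rewrite mulrC. Qed.

Lemma pairingZr (a : R) zeta z : pairing zeta (a *: z) = a * pairing zeta z.
Proof. by rewrite ![pairing zeta _]pairingC pairingZl. Qed.

Lemma pairingNr zeta z : pairing zeta (- z) = - pairing zeta z.
Proof. by rewrite ![pairing zeta _]pairingC pairingNl. Qed.

Lemma pairingBr zeta x y : pairing zeta (x - y) = pairing zeta x - pairing zeta y.
Proof. by rewrite ![pairing zeta _]pairingC pairingBl. Qed.

Lemma pairing0r zeta : pairing zeta 0 = 0.
Proof. by rewrite -(scale0r (0 : 'rV_d)) pairingZr mul0r. Qed.

Lemma pairing0l zeta : pairing 0 zeta = 0.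
Proof. by rewrite pairingC pairing0r. Qed.

Lemma pairing_suml (I : Type) (s : seq I) (F : I -> 'rV[R]_d) z :
  pairing (\sum_(i <- s) F i) z = \sum_(i <- s) pairing (F i) z.
Proof.
by elim/big_rec2: _ => [|i y1 y2 _ <-]; rewrite ?pairing0l ?pairingDl.
Qed.

Lemma pairing_mulmx (p : nat) (c : 'cV[R]_p) (A : 'M[R]_(d, p)) z :
  pairing (A *m c)^T z = (z *m A *m c) 0 0.
Proof.
by rewrite -mulmxA mxE /pairing; apply: eq_bigr => i _; rewrite mxE mulrC.
Qed.

Lemma pairing_continuous :
  continuous (fun p : 'rV[R]_d * 'rV[R]_d => pairing p.1 p.2).
Proof.
move=> p; rewrite /continuous_at /pairing; elim: index_enum => [|i s IHs].
  by under eq_fun do rewrite big_nil; rewrite big_nil; exact: cvg_cst.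
under eq_fun do rewrite big_cons; rewrite big_cons.
apply: cvgD IHs; apply: cvgM.
  apply: (@cvg_comp _ _ _ fst (fun z : 'rV[R]_d => z 0 i) (nbhs p) (nbhs p.1)).
    exact: cvg_fst.
  exact: coord_continuous.
apply: (@cvg_comp _ _ _ snd (fun z : 'rV[R]_d => z 0 i) (nbhs p) (nbhs p.2)).
  exact: cvg_snd.
exact: coord_continuous.
Qed.

Lemma pairing_continuousr zeta : continuous (pairing zeta).
Proof.
move=> x; rewrite /continuous_at /pairing; elim: index_enum => [|i s IHs].
  by under eq_fun do rewrite big_nil; rewrite big_nil; exact: cst_continuous.
under eq_fun do rewrite big_cons; rewrite big_cons.
have cc : {for x, continuous (fun z : 'rV[R]_d => z 0 i)} by exact: coord_continuous.
apply: cvgD IHs; apply: cvgM cc; exact: cst_continuous.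
Qed.

End pairing_lemmas.

Section norm_lemmas.
Context {R : realType} {d : nat}.
Variable N : 'rV[R]_d -> R.
Hypothesis normN : is_norm N.
Implicit Types x y z zeta xi : 'rV[R]_d.

Lemma is_norm0 : N 0 = 0.
Proof. by rewrite -(scale0r (0 : 'rV_d)) norm_homogeneous// normr0 mul0r. Qed.

Lemma is_normN x : N (- x) = N x.
Proof. by rewrite -scaleN1r norm_homogeneous// normrN1 mul1r. Qed.

Lemma is_norm_distC x y : N (x - y) = N (y - x).
Proof. by rewrite -opprB is_normN. Qed.

Lemma is_norm_ge0 x : 0 <= N x.
Proof.
have := norm_triangle normN x (- x).
by rewrite subrr is_norm0 is_normN; lra.
Qed.

(** Expansion in the standard basis and the triangle inequality; [C] is the sum of the norms of the
    basis vectors. *)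
Lemma is_norm_le_coord : exists2 C : R, 0 <= C & forall x (b : R),
  (forall i, `|x 0 i| <= b) -> N x <= C * b.
Proof.
exists (\sum_i N (delta_mx 0 i)) => [|x b xb].
  by apply: sumr_ge0 => i _; exact: is_norm_ge0.
rewrite [x in N x]row_sum_delta.
have NE : N (\sum_j x 0 j *: delta_mx 0 j) <= \sum_j N (x 0 j *: delta_mx 0 j).
  elim/big_ind2 : _ => [|x1 x2 y1 y2 h1 h2|//]; first by rewrite is_norm0.
  by rewrite (le_trans (norm_triangle normN _ _))// lerD.
rewrite (le_trans NE)// mulr_suml; apply: ler_sum => i _.
by rewrite norm_homogeneous// mulrC ler_wpM2l// is_norm_ge0.
Qed.

Lemma is_norm_continuous : continuous N.
Proof.
have [C C0 NC] := is_norm_le_coord.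
move=> x; apply/(@cvgrPdist_le _ _ _ (nbhs x)) => e e0.
(* [C] may vanish, as it does for [d = 0], hence the [+ 1]. *)
have d0 : 0 < e / (C + 1) by rewrite divr_gt0// ltr_wpDl.
apply: filterS (nbhsx_ballx x _ d0) => y [_ bxy].
have xy : N (x - y) <= e.
  rewrite (le_trans (NC _ (e / (C + 1)) _))//; last first.
    by rewrite mulrCA ler_piMr ?ltW// ltr_pdivrMr ?mul1r ?ltrDl// ltr_wpDl.
  by move=> i; rewrite !mxE ltW//; exact: bxy.
have := norm_triangle normN (x - y) y; have := norm_triangle normN (y - x) x.
rewrite !subrK (is_norm_distC y) => h1 h2.
by rewrite ler_norml; apply/andP; split; lra.
Qed.

(* Any nonzero x, rescaled by its largest coordinate, lands in one of the
   compact faces {y | y_i = 1, |y_j| <= 1} of the cube. *)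
Lemma is_norm_ge_coord : exists2 c : R, 0 < c & forall x i, c * `|x 0 i| <= N x.
Proof.
have face i : exists2 c : R, 0 < c &
    forall x, x 0 i = 1 -> (forall j, `|x 0 j| <= 1) -> c <= N x.
  pose A (j : 'I_d) : set R := if j == i then [set 1] else `[-1, 1]%classic.
  pose K := [set v : 'rV[R]_d | forall j, A j (v ord0 j)].
  have cK : compact K.
    apply: rV_compact => j; rewrite /A; case: eqP => _; first exact: compact_set1.
    exact: segment_compact.
  have KP x : x 0 i = 1 -> (forall j, `|x 0 j| <= 1) -> K x.
    by move=> xi xj j; rewrite /A; case: eqP => [->//|_] /=; rewrite in_itv/= -ler_norml.
  have K0 : K !=set0.
    exists (const_mx 1); apply: KP => [|j]; rewrite mxE// normr1//.
  have [] := @compact_EVT_min _ R N K K0 cK.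
    by apply: continuous_subspaceT; exact: is_norm_continuous.
  move=> x0 /set_mem Kx0 minx0; exists (N x0); last first.
    by move=> x xi xj; apply/minx0/mem_set; exact: KP.
  rewrite lt_neqAle is_norm_ge0 andbT eq_sym; apply/eqP => /(norm_definite normN) x00.
  by have := Kx0 i; rewrite /A eqxx x00 mxE /= => /eqP; rewrite eq_sym oner_eq0.
pose c i := sval (cid2 (face i)).
have c0 i : 0 < c i by rewrite /c; case: cid2.
have cN i x : x 0 i = 1 -> (forall j, `|x 0 j| <= 1) -> c i <= N x.
  by rewrite /c; case: cid2 => /= c' _; exact.
(* The initial value 1 keeps the minimum positive over an empty index set. *)
exists (\big[Num.min/1]_i c i) => [|x i]; first by apply/bigmin_gtP.
have [->|xn0] := eqVneq (x 0 i) 0; first by rewrite normr0 mulr0 is_norm_ge0.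
have [k _ kmax] := @Order.TotalTheory.arg_maxP _ _ _ i xpredT (fun j => `|x 0 j|) isT.
have {}kmax j : `|x 0 j| <= `|x 0 k| by exact: kmax.
have xk0 : 0 < `|x 0 k| by rewrite (lt_le_trans _ (kmax i))// normr_gt0.
have xkn0 : x 0 k != 0 by rewrite -normr_gt0.
have : c k <= N ((x 0 k)^-1 *: x).
  apply: cN => [|j]; rewrite mxE ?mulVf//.
  by rewrite normrM normfV ler_pdivrMl// mulr1 kmax.
rewrite norm_homogeneous// normfV ler_pdivlMl// mulrC; apply: le_trans.
apply: ler_pM => //; last exact: bigmin_le.
by apply: le_bigmin => // j _; exact: ltW.
Qed.
(** [sup] is informative only on nonempty bounded sets; boundedness holds because the unit ball of
    [N] lies in a cube of half-width [c^-1]. *)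
Lemma dual_norm_has_sup zeta :
  has_sup [set pairing zeta z | z in [set z | (N z <= 1)%R]].
Proof.
split; first by exists (pairing zeta 0), 0; rewrite //= is_norm0.
have [c c0 cN] := is_norm_ge_coord.
exists (\sum_i `|zeta 0 i| * c^-1) => _ [z /= Nz1 <-].
apply: ler_sum => i _; rewrite (le_trans (ler_norm _))// normrM ler_wpM2l//.
by rewrite -[leRHS]mul1r ler_pdivlMr// mulrC (le_trans (cN _ _)).
Qed.

Lemma pairing_le_unit zeta z : N z <= 1 -> pairing zeta z <= dual_norm N zeta.
Proof.
by move=> Nz; apply: ub_le_sup; [case: (dual_norm_has_sup zeta)|exists z].
Qed.

Lemma dual_norm_le zeta (b : R) :
  (forall z, N z <= 1 -> pairing zeta z <= b) -> dual_norm N zeta <= b.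
Proof.
move=> zb; apply: ge_sup; first by case: (dual_norm_has_sup zeta).
by move=> _ [z /= Nz <-]; exact: zb.
Qed.

Lemma dual_norm_ge0 zeta : 0 <= dual_norm N zeta.
Proof. by rewrite -(pairing0r zeta) pairing_le_unit// is_norm0. Qed.

Lemma pairing_le zeta z : pairing zeta z <= dual_norm N zeta * N z.
Proof.
have [/(norm_definite normN) ->|Nz0] := eqVneq (N z) 0.
  by rewrite pairing0r is_norm0 mulr0.
have Nzp : 0 < N z by rewrite lt_neqAle eq_sym Nz0 is_norm_ge0.
rewrite -ler_pdivrMr// mulrC -pairingZr pairing_le_unit//.
by rewrite norm_homogeneous// normfV ger0_norm ?is_norm_ge0// mulVf.
Qed.

Lemma pairing_norm_le zeta z : `|pairing zeta z| <= dual_norm N zeta * N z.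
Proof.
rewrite ler_norml pairing_le andbT lerNl -pairingNr.
by rewrite (le_trans (pairing_le _ _))// is_normN.
Qed.

Lemma dual_normD zeta xi :
  dual_norm N (zeta + xi) <= dual_norm N zeta + dual_norm N xi.
Proof. by apply: dual_norm_le => z Nz; rewrite pairingDl lerD// pairing_le_unit. Qed.

Lemma dual_normN zeta : dual_norm N (- zeta) = dual_norm N zeta.
Proof.
apply/eqP; rewrite eq_le; apply/andP; split; apply: dual_norm_le => z Nz.
  by rewrite pairingNl -pairingNr pairing_le_unit// is_normN.
by rewrite -[zeta in pairing zeta]opprK pairingNl -pairingNr pairing_le_unit// is_normN.
Qed.

(** By subadditivity it is enough to bound the dual norm of a vector with small coordinates, again
    through the cube around the unit ball. *)
Lemma dual_norm_continuous : continuous (dual_norm N).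
Proof.
have [c c0 cN] := is_norm_ge_coord.
move=> x; apply/(@cvgrPdist_le _ _ _ (nbhs x)) => e e0.
have d0 : 0 < e / (d%:R * c^-1 + 1) by rewrite divr_gt0// ltr_wpDl// mulr_ge0// invr_ge0 ltW.
apply: filterS (nbhsx_ballx x _ d0) => y [_ bxy].
have xy : dual_norm N (x - y) <= e.
  apply: dual_norm_le => z Nz.
  have h : pairing (x - y) z <= \sum_(i < d) e / (d%:R * c^-1 + 1) * c^-1.
    apply: ler_sum => i _; rewrite (le_trans (ler_norm _))// normrM ler_pM//.
      by rewrite !mxE ltW//; exact: bxy.
    by rewrite -[leRHS]mul1r ler_pdivlMr// mulrC (le_trans (cN _ _)).
  rewrite (le_trans h)// sumr_const card_ord -[leLHS]mulr_natr.
  have t0 : 0 <= d%:R * c^-1 by rewrite mulr_ge0// invr_ge0 ltW.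
  have -> : e / (d%:R / c + 1) / c * d%:R = e * ((d%:R / c) / (d%:R / c + 1)) by ring.
  by rewrite ler_piMr ?ltW// ltr_pdivrMr ?mul1r ?ltrDl// ltr_wpDl.
have := dual_normD (x - y) y; have := dual_normD (y - x) x.
rewrite !subrK -(opprB x y) dual_normN => h1 h2.
by rewrite ler_norml; apply/andP; split; lra.
Qed.

End norm_lemmas.

(** * Subgradients and the mirror map *)

(** A real [b] fits strictly between [psi t] and [h (q t)], so the set is a union of intersections
    of two open sets. This serves both the existence of minimizers and the closedness of the graph
    of the subdifferential. *)
Lemma lsc_open_gt {R : realType} {X T : topologicalType} (h : X -> \bar R)
    (q : T -> X) (psi : T -> R) :
  lower_semicontinuous h -> continuous q -> continuous psi ->
  open [set t | ((psi t)%:E < h (q t))%E].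
Proof.
move=> /lower_semicontinuousP hl cq cpsi.
rewrite [X in open X](_ : _ = \bigcup_(b : R)
  (q @^-1` [set x | (b%:E < h x)%E] `&` psi @^-1` [set y | y < b])).
  apply: bigcup_open => b _; apply: openI.
    by apply: open_comp => // t _; exact: cq.
  by apply: open_comp => [t _|]; [exact: cpsi|exact: open_lt].
apply/seteqP; split=> [t /= ht|t [b _ /= [bh pb]]]; last first.
  by apply: lt_trans bh; rewrite lte_fin.
case hE : (h (q t)) ht => [x| |] //=; rewrite ?lte_fin => ht.
  exists ((psi t + x) / 2) => //=; split; last by lra.
  by rewrite hE lte_fin; lra.
by exists (psi t + 1) => //=; split; [rewrite hE ltry|rewrite ltrDl].
Qed.

Section mirror_map.
Context {R : realType} {d : nat}.
Variables (Z : set 'rV[R]_d) (N r : 'rV[R]_d -> R).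
Hypotheses (normN : is_norm N) (dgf : distance_generating Z r N).
Implicit Types (z u v w c gamma : 'rV[R]_d).

Definition subdifferentiable : set 'rV[R]_d :=
  [set z | Z z /\ subdiff Z r z !=set0].

(** Stands in for the gradient of [r] at [z]: a subgradient that attains the supremum in
    [grad_pairing] on all directions into [Z] at once. The default 0 is returned only where there is
    none. *)
Definition max_subgradient z : 'rV[R]_d :=
  xget 0 [set gamma | subdiff Z r z gamma /\
    forall u, Z u -> grad_pairing Z r z (u - z) = (pairing gamma (u - z))%:E].

Lemma subdiff_le_grad_pairing z gamma x : subdiff Z r z gamma ->
  ((pairing gamma x)%:E <= grad_pairing Z r z x)%E.
Proof. by move=> zg; apply: ereal_sup_ubound; exists gamma. Qed.

Lemma grad_pairing_le z u : Z u -> (grad_pairing Z r z (u - z) <= (r u - r z)%:E)%E.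
Proof.
move=> Zu; apply: ge_ereal_sup => _ [gamma zg <-].
by rewrite lee_fin; have := zg _ Zu; lra.
Qed.

(* The three-point identity at z' = z says exactly that the support function
   of the subdifferential is linear on the directions of Z. *)
Lemma max_subgradientP z : subdifferentiable z ->
  subdiff Z r z (max_subgradient z) /\ forall u, Z u ->
    grad_pairing Z r z (u - z) = (pairing (max_subgradient z) (u - z))%:E.
Proof.
move=> [Zz Dz]; pose P := [set gamma | subdiff Z r z gamma /\
  forall u, Z u -> grad_pairing Z r z (u - z) = (pairing gamma (u - z))%:E].
apply: (@xgetPex _ 0 P).
have [gamma zg id3] := dgf_three_point dgf Zz Dz; exists gamma; split=> // u Zu.
(* Any subgradient bounds the supremum below, and [r v - r z] bounds it above. *)
have fin v : Z v -> exists x : R, grad_pairing Z r z (v - z) = x%:E.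
  move=> Zv; have := grad_pairing_le z Zv; have := subdiff_le_grad_pairing (v - z) zg.
  by case: grad_pairing => [x| |]//; exists x.
have [x ux] := fin u Zu; have [y zy] := fin z Zz.
have y0 : y = 0.
  move: zy; rewrite /grad_pairing subrr => y0.
  have : ereal_sup [set (pairing gamma0 0)%:E | gamma0 in subdiff Z r z] = 0%:E.
    apply/eqP; rewrite eq_le; apply/andP; split.
      by apply: ge_ereal_sup => _ [g' _ <-]; rewrite pairing0r.
    by apply: ereal_sup_ubound; exists gamma => //; rewrite pairing0r.
  by rewrite y0 => -[].
have := id3 z u Zz Zu; rewrite /bregman ux zy y0 -!EFinB => -[] h.
by congr (_%:E); lra.
Qed.

(** Real-valued form of [bregman], open to linear arithmetic; the two agree wherever a subgradient
    exists, by [bregmanE]. *)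
Definition divergence z u : R := r u - r z - pairing (max_subgradient z) (u - z).

Lemma bregmanE z u : subdifferentiable z -> Z u ->
  bregman Z r z u = (divergence z u)%:E.
Proof. by move=> /max_subgradientP[_ zE] Zu; rewrite /bregman zE// -!EFinB. Qed.

Lemma bregman_nondifferentiable z u : ~ (subdiff Z r z !=set0) ->
  bregman Z r z u = +oo%E.
Proof.
move=> /set0P/negP/negPn/eqP z0.
by rewrite /bregman /grad_pairing z0 image_set0 ereal_sup0.
Qed.

Lemma subdiff_strong z u gamma : Z z -> Z u -> subdiff Z r z gamma ->
  r z + pairing gamma (u - z) + 2^-1 * N (u - z) ^+ 2 <= r u.
Proof.
move=> Zz Zu zg; rewrite -lee_fin; apply: le_trans (dgf_strongly_convex dgf Zz Zu).
by rewrite !EFinD leeD2r// leeD2l// subdiff_le_grad_pairing.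
Qed.

Lemma divergence_ge z u : subdifferentiable z -> Z u ->
  2^-1 * N (u - z) ^+ 2 <= divergence z u.
Proof.
move=> Dz Zu; have [zg _] := max_subgradientP Dz.
by have := subdiff_strong Dz.1 Zu zg; rewrite /divergence; lra.
Qed.

Lemma max_subgradient_ge z u gamma : subdifferentiable z -> Z u ->
  subdiff Z r z gamma -> pairing gamma (u - z) <= pairing (max_subgradient z) (u - z).
Proof.
move=> Dz Zu zg; rewrite -lee_fin -(max_subgradientP Dz).2//.
exact: subdiff_le_grad_pairing.
Qed.

(** The common shape of the mirror steps and of the ghost iterates; membership of [w] amounts to
    [- c] being a subgradient at [w]. *)
Definition linear_min c : set 'rV[R]_d :=
  [set w | Z w /\ forall v, Z v -> pairing c w + r w <= pairing c v + r v].

Lemma linear_min_subdiff c w : linear_min c w -> subdiff Z r w (- c).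
Proof.
by move=> [_ minw] v Zv; have := minw v Zv; rewrite pairingNl pairingBr; lra.
Qed.

Lemma linear_min_subdifferentiable c w : linear_min c w -> subdifferentiable w.
Proof.
by move=> cw; split; [case: cw|exists (- c); exact: linear_min_subdiff].
Qed.

(** Adding strong convexity at [w1] with subgradient [- c1] and at [w2] with [- c2] gives [N (w1 -
    w2) ^+ 2 <= pairing (c1 - c2) (w2 - w1)]. *)
Lemma linear_min_lipschitz c1 c2 w1 w2 : linear_min c1 w1 -> linear_min c2 w2 ->
  N (w1 - w2) <= dual_norm N (c1 - c2).
Proof.
move=> m1 m2; have [Z1 Z2] := (m1.1, m2.1).
have h1 := subdiff_strong Z1 Z2 (linear_min_subdiff m1).
have h2 := subdiff_strong Z2 Z1 (linear_min_subdiff m2).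
have h3 := pairing_le normN (c1 - c2) (w2 - w1).
have N0 := is_norm_ge0 normN (w1 - w2).
have D0 := dual_norm_ge0 normN (c1 - c2).
move: h1 h2 h3; rewrite (is_norm_distC normN w2 w1) !pairingBl !pairingNl !pairingBr.
by move=> h1 h2 h3; rewrite leNgt; apply/negP => h4; nra.
Qed.

Lemma linear_min_uniq c w1 w2 : linear_min c w1 -> linear_min c w2 -> w1 = w2.
Proof.
move=> m1 m2; apply/eqP; rewrite -subr_eq0; apply/eqP/(norm_definite normN).
apply/eqP; rewrite eq_le is_norm_ge0// andbT.
rewrite (le_trans (linear_min_lipschitz m1 m2))// subrr.
by apply: dual_norm_le => // z _; rewrite pairing0l.
Qed.

Hypotheses (compZ : compact Z) (Z0 : Z !=set0).

(** Weierstrass for a lower semicontinuous function: without a minimizer, the open sets [U v] of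
    points with a value above [F v] would cover [Z]. *)
Lemma linear_min_exists c : linear_min c !=set0.
Proof.
pose rt z : \bar R := if z \in Z then (r z)%:E else +oo%E.
pose F v := pairing c v + r v.
pose U v := [set x | ((F v - pairing c x)%:E < rt x)%E].
have Uo v : open (U v).
  have cid : continuous (@id 'rV[R]_d) by move=> x; exact: cvg_id.
  suff : continuous (fun x => F v - pairing c x) by exact: lsc_open_gt (dgf_lsc dgf) cid.
  move=> x; apply: (@continuousB _ _ _ (cst (F v)) (pairing c)).
    exact: cst_continuous.
  exact: pairing_continuousr.
apply: contrapT => nmin.
have cov : Z `<=` \bigcup_(v in Z) U v.
  move=> x Zx; apply: contrapT => nx; apply: nmin; exists x; split=> // v Zv.
  rewrite leNgt; apply/negP => lt; apply: nx; exists v => //.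
  by rewrite /U /= /rt mem_set// lte_fin /F; lra.
have := compZ; rewrite compact_cover => /(_ _ _ _ (fun v _ => Uo v) cov) [D' D'Z].
move=> cov'; have [z1 Zz1] := Z0.
have [v1 /= v1D' _] := cov' _ Zz1.
(* The best index [v2] of the finite subcover lies in some [U v3], so [F v3 < F v2], a
   contradiction. *)
have [v2 v2D' v2min] := @Order.TotalTheory.arg_minP _ _ _ (FSetSub v1D') xpredT
  (fun v : D' => F (val v)) isT.
have Zv2 : Z (val v2) by exact: set_mem (D'Z _ (valP v2)).
have [v3 /= v3D'] := cov' _ Zv2; rewrite /U /= /rt mem_set// lte_fin => lt.
by have := v2min (FSetSub v3D') isT; rewrite /= /F; move: lt; rewrite /F; lra.
Qed.

Definition mirror_map c : 'rV[R]_d := xget 0 (linear_min c).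

Lemma mirror_mapP c : linear_min c (mirror_map c).
Proof. by apply: (@xgetPex _ 0 (linear_min c)); exact: linear_min_exists. Qed.

Lemma mirror_map_continuous : continuous mirror_map.
Proof.
have [k k0 kN] := is_norm_ge_coord normN.
move=> c; apply/(@cvg_ballP _ _ _ (nbhs c)) => e e0.
have ke : 0 < k * e by rewrite mulr_gt0.
have cdual : {for c, continuous (dual_norm N \o (fun x => c - x))}.
  apply: continuous_comp; last exact: dual_norm_continuous.
  by apply: continuousB; [exact: cst_continuous|exact: cvg_id].
move: cdual => /(@cvgrPdist_lt _ _ _ (nbhs c)) /(_ _ ke).
apply: filterS => x /=; rewrite subrr.
have -> : dual_norm N 0 = 0.
  apply/eqP; rewrite eq_le dual_norm_ge0// andbT.
  by apply: dual_norm_le => // z _; rewrite pairing0l.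
rewrite sub0r normrN ger0_norm ?dual_norm_ge0// => cx.
have {}cx := le_lt_trans (linear_min_lipschitz (mirror_mapP c) (mirror_mapP x)) cx.
split=> // i j; rewrite (ord1 i) -ball_normE /=.
have := kN (mirror_map c - mirror_map x) j; rewrite !mxE => h.
by rewrite -(ltr_pM2l k0) (le_lt_trans h).
Qed.

End mirror_map.

(** * Borel measurability of subgradients and of minimizers *)

Notation borel_rV R d := (g_sigma_algebraType (@open 'rV[R]_d)).

Section borel_row_vectors.
Context {R : realType} {d : nat}.
Implicit Types x y z : 'rV[R]_d.

Lemma measurable_borel_rVE :
  @measurable _ (borel_rV R d) = <<s (@open 'rV[R]_d) >>.
Proof. by []. Qed.

Lemma open_measurable_rV (U : set 'rV[R]_d) : open U -> measurable (U : set (borel_rV R d)).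
Proof. by move=> oU; exact: sub_sigma_algebra. Qed.

Lemma closed_measurable_rV (U : set 'rV[R]_d) :
  closed U -> measurable (U : set (borel_rV R d)).
Proof.
move=> cU; rewrite -[U]setCK; apply: measurableC; apply: open_measurable_rV.
exact: closed_openC.
Qed.

Lemma compact_measurable_rV (U : set 'rV[R]_d) :
  compact U -> measurable (U : set (borel_rV R d)).
Proof.
move=> cU; apply: closed_measurable_rV; exact: compact_closed.
Qed.

Lemma continuous_measurable_rV (f : 'rV[R]_d -> R) :
  continuous f -> measurable_fun setT (f : borel_rV R d -> R).
Proof.
move=> /continuousP cf; apply: (measurability _ (RGenOpens.measurableE R)).
move=> _ [_ [a [b ->] <-]]; rewrite setTI; apply: open_measurable_rV; exact/cf/interval_open.
Qed.

Lemma within_continuous_measurable_rV (D : set 'rV[R]_d) (f : 'rV[R]_d -> R) :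
  measurable (D : set (borel_rV R d)) -> {within D, continuous f} ->
  measurable_fun (D : set (borel_rV R d)) (f : borel_rV R d -> R).
Proof.
move=> mD /continuousP cf; apply: (measurability _ (RGenOpens.measurableE R)).
move=> _ [_ [a [b ->] <-]].
have oab : open (`]a, b[%classic : set R) by exact: interval_open.
have [V oV VE] := (open_subspaceP _ _).1 (cf _ oab).
rewrite setIC -VE.
by apply: measurableI => //; exact: open_measurable_rV.
Qed.

Lemma coord_measurable_rV (i : 'I_d) :
  measurable_fun setT ((fun x : 'rV[R]_d => x 0 i) : borel_rV R d -> R).
Proof. by apply: continuous_measurable_rV; exact: coord_continuous. Qed.

Lemma continuous_measurable_rV_rV (f : 'rV[R]_d -> 'rV[R]_d) :
  continuous f -> measurable_fun setT (f : borel_rV R d -> borel_rV R d).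
Proof.
move=> /continuousP cf; apply: (measurability _ measurable_borel_rVE).
by move=> _ [U oU <-]; rewrite setTI; apply: open_measurable_rV; exact: cf.
Qed.

(** The index set is countable, which reduces Borel measurability of vector-valued maps to that of
    their coordinates. *)
Lemma open_bigcup_rat_box (U : set 'rV[R]_d) : open U ->
  U = \bigcup_(qk in [set qk : 'rV[rat]_d * nat |
        [set x : 'rV[R]_d | forall i, `|x 0 i - ratr (qk.1 0 i)| < qk.2.+1%:R^-1] `<=` U])
      [set x : 'rV[R]_d | forall i, `|x 0 i - ratr (qk.1 0 i)| < qk.2.+1%:R^-1].
Proof.
move=> oU; apply/seteqP; split=> [x Ux|x [qk + xqk]]; last by apply.
have /nbhs_ballP[e /= e0 xeU] : nbhs x U by exact: open_nbhs_nbhs.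
have e20 : 0 < e / 2 by rewrite divr_gt0.
pose k := Num.truncn (e / 2)^-1.
have k0 : k.+1%:R^-1 < e / 2 by rewrite invf_plt ?posrE// truncnS_gt.
have q_ex i : exists q : rat, `|x 0 i - ratr q| < k.+1%:R^-1.
  have : 0 < k.+1%:R^-1 :> R by rewrite invr_gt0.
  move: (k.+1%:R^-1) => kinv kinv0.
  have [|q] := @rat_in_itvoo _ (x 0 i - kinv) (x 0 i + kinv); first by lra.
  by rewrite in_itv /= => /andP[? ?]; exists q; rewrite ltr_norml; apply/andP; split; lra.
exists (\row_i sval (cid (q_ex i)), k) => /=; last first.
  by move=> i; rewrite mxE; case: cid.
move=> y yq; apply: xeU; split=> // i j; rewrite (ord1 i) -ball_normE /=.
have := yq j; rewrite mxE; case: cid => /= q xq yqj.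
rewrite -(subrK (ratr q) (x 0 j)) -addrA (le_lt_trans (ler_normD _ _))// (distrC (ratr q)).
by move: k0 xq yqj; move: (k.+1%:R^-1) => kinv; lra.
Qed.

Lemma measurable_fun_rV {dT : measure_display} {T : measurableType dT} (D : set T)
    (h : T -> 'rV[R]_d) :
  (forall i, measurable_fun D (fun t => h t 0 i)) ->
  measurable_fun D (h : T -> borel_rV R d).
Proof.
move=> mh mD; apply: (measurability _ measurable_borel_rVE) (mD).
move=> _ [U oU <-]; rewrite (open_bigcup_rat_box oU) preimage_bigcup setI_bigcupr.
rewrite bigcup_mkcond; apply: countable_bigcupT_measurable.
  exact: countableP.
move=> [q k]; case: ifPn => // _.
(* The inner [D] matches what measurability on [D] provides; the outer one is needed when [d = 0]
   and the intersection is empty. *)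
rewrite (_ : _ `&` _ = D `&` \bigcap_i (D `&`
  (fun t => h t 0 i) @^-1` ball (ratr (q 0 i) : R) k.+1%:R^-1)); last first.
  apply/seteqP; split=> t /= [Dt ht]; split=> // i; first by rewrite -ball_normE /= distrC.
  by have [_] := ht i I; rewrite -ball_normE /= distrC.
apply: measurableI => //; apply: (@fin_bigcap_measurable _ T 'I_d setT) => [|i _].
  exact: finite_finset.
by apply: mh => //; exact: measurable_ball.
Qed.

End borel_row_vectors.

Section measurable_subgradients.
Context {R : realType} {d : nat}.
Variables (Z : set 'rV[R]_d) (N r : 'rV[R]_d -> R).
Hypotheses (normN : is_norm N) (dgf : distance_generating Z r N) (compZ : compact Z).
Implicit Types (z u v w c gamma : 'rV[R]_d).

(* {z | c < sup_gamma <gamma, u - z>} is sigma-compact: it is the union over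
   K, m of the projections of the compact sets of pairs (z, gamma) with gamma a
   subgradient at z bounded by K and c + 1/(m+1) <= <gamma, u - z>. *)
Lemma grad_pairing_measurable u : measurable_fun (Z : set (borel_rV R d))
  (fun z : borel_rV R d => grad_pairing Z r z (u - z)).
Proof.
move=> mZ; apply: (measurability _ (ErealGenOInfty.measurableE R)) => //.
move=> _ [_ [c ->] <-].
pose box (K : nat) := [set gamma : 'rV[R]_d | forall i, `[- K%:R, K%:R]%classic (gamma ord0 i)].
pose rt z : \bar R := if z \in Z then (r z)%:E else +oo%E.
(* Over [Z], this is the graph of the subdifferential; lower semicontinuity of [rt] makes it
   closed. *)
pose C := \bigcap_(v in Z) ~` [set p : 'rV[R]_d * 'rV[R]_d |
  ((r v - pairing p.2 (v - p.1))%:E < rt p.1)%E].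
pose A m := [set p : 'rV[R]_d * 'rV[R]_d | c + m.+1%:R^-1 <= pairing p.2 (u - p.1)].
pose S (Km : nat * nat) := (Z `*` box Km.1) `&` (C `&` A Km.2).
have cpair v : continuous (fun p : 'rV[R]_d * 'rV[R]_d => pairing p.2 (v - p.1)).
  rewrite (_ : (fun p => _) = fun p : 'rV[R]_d * 'rV[R]_d =>
    pairing v p.2 - pairing p.1 p.2); last first.
    by apply/funext => p; rewrite pairingBr pairingC [in LHS](pairingC p.2).
  move=> p; apply: cvgB; last exact: pairing_continuous.
  apply: (@cvg_comp _ _ _ snd (pairing v) (nbhs p) (nbhs p.2)); first exact: cvg_snd.
  exact: pairing_continuousr.
have cC : closed C.
  apply: closed_bigI => v _; apply: open_closedC.
  apply: (lsc_open_gt (dgf_lsc dgf)); first by move=> p; exact: cvg_fst.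
  by move=> p; apply: cvgB; [exact: cvg_cst|exact: cpair].
have cA m : closed (A m).
  rewrite (_ : A m = (fun p => pairing p.2 (u - p.1)) @^-1` [set y | c + m.+1%:R^-1 <= y])//.
  apply: preimage_closed; last exact: closed_ge.
  by move=> p _; exact: cpair.
have cS Km : compact (S Km).
  apply: compact_closedI; last by apply: closedI.
  have cbox : compact (box Km.1).
    pose I := `[- Km.1%:R, Km.1%:R]%classic : set R.
    exact: (@rV_compact R d (fun=> I) (fun=> @segment_compact R _ _)).
  exact: compact_setX.
rewrite (_ : _ `&` _ = \bigcup_Km (fst @` S Km)).
  apply: countable_bigcupT_measurable => [|Km]; first exact: countableP.
  apply: compact_measurable_rV; apply: continuous_compact (cS Km).
  by apply: continuous_subspaceT => p; exact: cvg_fst.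
apply/seteqP; split=> [z [Zz /=]|z [[K m] _ [[z' gamma]]]]; last first.
  move=> [[/= Zz' _] [Cg Ag]] <-; split=> //=.
  rewrite in_itv/= andbT (@lt_le_trans _ _ (pairing gamma (u - z'))%:E)//.
    by rewrite lte_fin (lt_le_trans _ Ag)//= ltrDl.
  apply: subdiff_le_grad_pairing => v Zv.
  by have := Cg v Zv; rewrite /= /rt mem_set// lte_fin => /negP; rewrite -leNgt; lra.
rewrite in_itv/= andbT => /ereal_sup_gt[_ [gamma zg <-]]; rewrite lte_fin => cg.
(* [K.+1] exceeds every coordinate of [gamma] in absolute value, and [m.+1%:R^-1] is below the gap
   between the pairing and [c]. *)
pose K := Num.truncn (\sum_i `|gamma 0 i|).
pose m := Num.truncn (pairing gamma (u - z) - c)^-1.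
exists (K.+1, m) => //; exists (z, gamma) => //; split; [split=> //= i|split=> [v Zv|]] => /=.
- rewrite in_itv/= -ler_norml ltW// (le_lt_trans _ (truncnS_gt _))//.
  by rewrite (bigD1 i)//= lerDl sumr_ge0.
- apply/negP; rewrite -leNgt /rt mem_set// lee_fin.
  by have := zg v Zv; lra.
- rewrite /A /= -lerBrDl ltW// invf_plt ?posrE ?subr_gt0//.
  exact: truncnS_gt.
Qed.

(* Only the values of c on the directions of Z matter, and these are determined
   by finitely many of them. *)
Lemma linear_min_measurable {dT : measure_display} {T : measurableType dT}
    (u0 : 'rV[R]_d) (c w : T -> 'rV[R]_d) : Z u0 ->
  (forall u, Z u -> measurable_fun setT (fun t => pairing (c t) (u - u0))) ->
  (forall t, linear_min Z r (c t) (w t)) ->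
  measurable_fun setT (w : T -> borel_rV R d).
Proof.
move=> Zu0 mc cw.
pose good k := exists (p : nat) (A : 'M[R]_(p, d)),
  (forall i, Z (row i A + u0)) /\ \rank A = k.
have [p [A [ZA spanA]]] : exists p (A : 'M[R]_(p, d)),
    (forall i, Z (row i A + u0)) /\ forall u, Z u -> (u - u0 <= A)%MS.
  (* A matrix of maximal rank among those with rows in [Z - u0] spans all directions: any other
     direction could be appended and would raise the rank. *)
  pose gb k := `[< good k >].
  have ex : exists k, gb k.
    by exists 0%N; apply/asboolP; exists 0%N, 0; split=> [[]//|]; rewrite mxrank0.
  have ub k : gb k -> (k <= d)%N by move=> /asboolP[p [A [_ <-]]]; exact: rank_leq_col.
  have [_ /asboolP[p [A [ZA <-]]] maxA] := ex_maxnP ex ub.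
  exists p, A; split=> // u Zu; apply: contrapT => /negP nuA.
  have : (\rank A < \rank (col_mx A (u - u0)))%N.
    apply: rank_ltmx; rewrite ltmxE; apply/andP; split.
      by rewrite -addsmxE addsmxSl.
    apply: contra nuA; apply: submx_trans.
    by rewrite -addsmxE addsmxSr.
  rewrite ltnNge => /negP; apply; apply: maxA; apply/asboolP.
  exists (p + 1)%N, (col_mx A (u - u0)); split=> // i.
  case: (split_ordP i) => j ->; first by rewrite rowKu.
  by rewrite rowKd (ord1 j) row_id subrK.
(* [ct t] agrees with [c t] on the span of [A], hence has the same minimizer, and depends on [c t]
   only through its measurable values on the rows of [A]. *)
pose ct t := (pinvmx A *m (A *m (c t)^T))^T.
have ctE t v : Z v -> pairing (ct t) (v - u0) = pairing (c t) (v - u0).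
  move=> Zv; rewrite /ct pairing_mulmx mulmxA mulmxKpV ?spanA// pairingC /pairing [LHS]mxE.
  by apply: eq_bigr => j _; rewrite [X in _ * X = _]mxE.
have ctw t : linear_min Z r (ct t) (w t).
  have [Zw minw] := cw t; split=> // v Zv.
  by have := minw v Zv; have := ctE t v Zv; have := ctE t _ Zw; rewrite !pairingBr; lra.
have Z0 : Z !=set0 by exists u0.
have -> : w = mirror_map Z r \o ct.
  apply/funext => t; apply: (linear_min_uniq normN dgf (ctw t)).
  exact: (mirror_mapP dgf compZ Z0 (ct t)).
apply: (measurableT_comp (f := mirror_map Z r : borel_rV R d -> borel_rV R d)).
  by apply: continuous_measurable_rV_rV; exact: mirror_map_continuous normN dgf compZ Z0.
apply: measurable_fun_rV => j; rewrite /ct.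
under eq_fun do rewrite mxE mxE.
apply: measurable_sum => i; apply: measurable_funM => //.
rewrite (_ : (fun _ => _) = fun t => pairing (c t) (row i A + u0 - u0)); first exact: mc.
apply/funext => t; rewrite addrK mxE pairingC /pairing; apply: eq_bigr => k _.
by rewrite !mxE.
Qed.

(** On directions of [Z] the pairing is a difference of two values of [grad_pairing], at [u - z] and
    [u' - z]. *)
Lemma max_subgradient_measurable {dT : measure_display} {T : measurableType dT}
    (z : T -> 'rV[R]_d) u u' :
  measurable_fun setT (z : T -> borel_rV R d) ->
  (forall t, subdifferentiable Z r (z t)) -> Z u -> Z u' ->
  measurable_fun setT (fun t => pairing (max_subgradient Z r (z t)) (u - u')).
Proof.
move=> mz Dz Zu Zu'.
have mZ : measurable (Z : set (borel_rV R d)) by exact: compact_measurable_rV.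
have mgp v : Z v -> measurable_fun setT
    (fun t => fine (grad_pairing Z r (z t) (v - z t))).
  move=> Zv; apply: (measurableT_comp (f := fine)); first exact: fine_measurable.
  apply: (measurable_comp mZ _ (grad_pairing_measurable v) mz) => _ [t _ <-].
  by case: (Dz t).
rewrite (_ : (fun _ => _) = fun t => fine (grad_pairing Z r (z t) (u - z t)) -
    fine (grad_pairing Z r (z t) (u' - z t))).
  by apply: measurable_funB; exact: mgp.
apply/funext => t; have [_ zE] := max_subgradientP dgf (Dz t).
by rewrite !zE//= !pairingBr; lra.
Qed.

End measurable_subgradients.

(** * Pathwise regret bounds *)

(** One summand of the final bound: [c] is the estimate drawn at [z], and [y] the offset from the
    ghost iterate to [z]. *)
Definition excess {R : realType} {d : nat} (N : 'rV[R]_d -> R) (alpha eta : R)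
    (g : 'rV[R]_d -> 'rV[R]_d) (z0 z c y : 'rV[R]_d) : R :=
  - (alpha / 4) * N (z - z0) ^+ 2
  + eta / 2 * (dual_norm N (c - g z0) ^+ 2 + dual_norm N (g z - c) ^+ 2)
  + pairing (g z - c) y.

Section mirror_descent.
Context {R : realType} {d : nat}.
Variables (Z : set 'rV[R]_d) (N r : 'rV[R]_d -> R).
Hypotheses (normN : is_norm N) (dgf : distance_generating Z r N).
Implicit Types (z u v w c gamma : 'rV[R]_d).
Local Notation V := (divergence Z r).
Local Notation grad := (max_subgradient Z r).
Local Notation D := (subdifferentiable Z r).

(** Each divergence is [r] minus an affine function, so the objective is [a + b] times a linear
    function plus [r], up to a constant. *)
Lemma argmin_linear_min (a b : R) z0 z c w : 0 < a -> 0 < b -> D z0 -> D z ->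
  argmin Z (fun v => (pairing c v)%:E + a%:E * bregman Z r z0 v +
                     b%:E * bregman Z r z v)%E w ->
  linear_min Z r ((a + b)^-1 *: (c - a *: grad z0 - b *: grad z)) w.
Proof.
move=> a0 b0 Dz0 Dz [Zw minw]; split=> // v Zv; have := minw v Zv.
have ab0 : 0 < a + b by rewrite addr_gt0.
rewrite !(bregmanE dgf)// -!EFinM -!EFinD lee_fin => h.
rewrite -(ler_pM2l ab0) !mulrDr !pairingZl !mulVKf ?gt_eqF//.
by move: h; rewrite /divergence !(pairingBl, pairingZl, pairingBr); lra.
Qed.

(** Optimality gives a subgradient at [w], which [max_subgradient] dominates towards [u]; the rest
    is the three-point identity for both divergences. *)
Lemma linear_min_regret (a b : R) z0 z c w u : 0 < a -> 0 < b -> Z u ->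
  linear_min Z r ((a + b)^-1 *: (c - a *: grad z0 - b *: grad z)) w ->
  pairing c (w - u) <=
    a * (V z0 u - V w u - V z0 w) + b * (V z u - V w u - V z w).
Proof.
move=> a0 b0 Zu minw; have ab0 : 0 < a + b by rewrite addr_gt0.
have := max_subgradient_ge dgf (linear_min_subdifferentiable minw) Zu
  (linear_min_subdiff minw).
rewrite -(ler_pM2l ab0) pairingNl pairingZl mulrN mulVKf ?gt_eqF//.
by rewrite /divergence !(pairingBl, pairingZl, pairingBr); lra.
Qed.

(** * Dual averaging on the noise *)

Section ghost_iterates.
Hypotheses (compZ : compact Z) (Z0 : Z !=set0).
Variables (eta : R) (w0 : 'rV[R]_d) (eps : nat -> 'rV[R]_d).
Hypothesis Dw0 : D w0.

(** Minimizes [eta] times the accumulated noise plus the divergence from [w0]. Only [eps i] with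
    [i < t] enter, so the iterate is known before the sample of time [t] is drawn. *)
Definition ghost t : 'rV[R]_d :=
  mirror_map Z r (eta *: \sum_(i < t) eps i - grad w0).

(* Dual averaging: the minimal value Phi_t of <c_t, v> + r v increases at each
   step by at least eta <eps_t, s_t> - eta^2 |eps_t|^2 / 2. *)
Lemma ghost_regret n u : 0 < eta -> Z u ->
  \sum_(t < n) pairing (eps t) (ghost t - u) <=
    eta^-1 * V w0 u + eta / 2 * \sum_(t < n) dual_norm N (eps t) ^+ 2.
Proof.
move=> eta0 Zu.
pose c t := eta *: \sum_(i < t) eps i - grad w0.
pose Phi t := pairing (c t) (ghost t) + r (ghost t).
have cmin t : linear_min Z r (c t) (ghost t) by exact: (mirror_mapP dgf compZ Z0).
have step t : Phi t + eta * pairing (eps t) (ghost t) -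
    eta ^+ 2 / 2 * dual_norm N (eps t) ^+ 2 <= Phi t.+1.
  have h1 := subdiff_strong dgf (cmin t).1 (cmin t.+1).1 (linear_min_subdiff (cmin t)).
  have h2 := pairing_le normN (eps t) (ghost t - ghost t.+1).
  rewrite (is_norm_distC normN) in h2.
  have -> : Phi t.+1 = pairing (c t) (ghost t.+1) + eta * pairing (eps t) (ghost t.+1)
      + r (ghost t.+1).
    by rewrite /Phi /c big_ord_recr /= !(pairingBl, pairingZl, pairingDl); ring.
  (* Young's inequality: the quadratic gain of strong convexity pays for moving from [ghost t] to
     [ghost t.+1]. *)
  have h3 := sqr_ge0 (N (ghost t.+1 - ghost t) - eta * dual_norm N (eps t)).
  have h4 : eta * pairing (eps t) (ghost t - ghost t.+1) <=
    eta * (dual_norm N (eps t) * N (ghost t.+1 - ghost t)) by rewrite ler_pM2l.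
  by move: h1 h3 h4; rewrite /Phi pairingNl !pairingBr; lra.
have steps : Phi 0%N + eta * (\sum_(t < n) pairing (eps t) (ghost t)) -
    eta ^+ 2 / 2 * (\sum_(t < n) dual_norm N (eps t) ^+ 2) <= Phi n.
  elim: n => [|n IHn]; first by rewrite !big_ord0; lra.
  by rewrite !big_ord_recr /=; have := step n; move: IHn; lra.
(* The subgradient inequality at [w0] bounds the initial value from below, and testing with [u]
   bounds the final one from above; the difference produces [V w0 u]. *)
have Phi0 : r w0 - pairing (grad w0) w0 <= Phi 0%N.
  rewrite /Phi /c big_ord0 scaler0 sub0r pairingNl.
  by have := (max_subgradientP dgf Dw0).1 _ (cmin 0%N).1; rewrite pairingBr; lra.
have Phin : Phi n <= eta * (\sum_(t < n) pairing (eps t) u) - pairing (grad w0) u + r u.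
  have := (cmin n).2 _ Zu; rewrite -/(Phi n) /c pairingBl pairingZl.
  by rewrite pairing_suml.
rewrite -(ler_pM2l eta0) mulrDr mulVKf ?gt_eqF//.
have -> : \sum_(t < n) pairing (eps t) (ghost t - u) =
    \sum_(t < n) pairing (eps t) (ghost t) - \sum_(t < n) pairing (eps t) u.
  by rewrite -sumrB; apply: eq_bigr => t _; rewrite pairingBr.
by move: steps Phi0 Phin; rewrite /divergence !pairingBr; lra.
Qed.

End ghost_iterates.

(** * Regret along a single trajectory *)

Section pathwise_bound.
Variables (alpha L eta : R) (T : nat) (g : 'rV[R]_d -> 'rV[R]_d).
Variables (w gam s : nat -> 'rV[R]_d).
Hypotheses (alpha_gt0 : 0 < alpha) (eta_gt0 : 0 < eta).
Hypothesis etaL : eta * L ^+ 2 = alpha / 10.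
Hypothesis T_ge : 4 / (eta * alpha) <= T%:R.
Hypothesis Dw0 : D (w 0%N).
Hypothesis g_lip : forall z, Z z ->
  dual_norm N (g z - g (w 0%N)) <= L * N (z - w 0%N).
Hypothesis w_step : forall t, (t < T)%N -> linear_min Z r
  ((alpha / 2 + eta^-1)^-1 *:
   (gam t - (alpha / 2) *: grad (w 0%N) - eta^-1 *: grad (w t))) (w t.+1).
Let eps t := g (w t) - gam t.

Lemma iterate_subdifferentiable t : (t <= T)%N -> D (w t).
Proof. by case: t => // t tT; exact: linear_min_subdifferentiable (w_step tT). Qed.

(** By induction on [n]. The term [pairing (g (w n) - g (w 0)) (w n - u)] telescopes the shift from
    [w t] to [w t.+1], leaving [pairing (gam t - g (w 0)) (w t - w t.+1)] to Young's inequality. The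
    squared distances to [w 0] are those of times 1 to [n], reindexed since that of time 0
    vanishes. *)
Lemma partial_regret u n : (n <= T)%N -> Z u ->
  \sum_(t < n) pairing (g (w t.+1)) (w t.+1 - u) <=
    alpha / 2 * n%:R * V (w 0%N) u + eta^-1 * (V (w 0%N) u - V (w n) u)
    - alpha / 4 * (\sum_(t < n) N (w t - w 0%N) ^+ 2) - alpha / 4 * N (w n - w 0%N) ^+ 2
    + eta / 2 * (\sum_(t < n) dual_norm N (gam t - g (w 0%N)) ^+ 2)
    + pairing (g (w n) - g (w 0%N)) (w n - u)
    + \sum_(t < n) pairing (eps t) (w t - u).
Proof.
move=> nT Zu; elim: n nT => [|n IHn] nT.
  by rewrite !big_ord0 !subrr is_norm0// pairing0l; lra.
rewrite !big_ord_recr /= -[n.+1%:R]natr1; have {IHn} := IHn (ltnW nT).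
have a0 : 0 < alpha / 2 by rewrite divr_gt0.
have b0 : 0 < eta^-1 by rewrite invr_gt0.
have Zn : Z (w n.+1) by case: (w_step nT).
have h1 := linear_min_regret a0 b0 Zu (w_step nT).
have h2 := pairing_le normN (gam n - g (w 0%N)) (w n - w n.+1).
rewrite (is_norm_distC normN) in h2.
have h3 : 0 <= alpha / 2 * V (w n.+1) u.
  apply: mulr_ge0; first exact: ltW.
  apply: le_trans (divergence_ge dgf (iterate_subdifferentiable nT) Zu).
  by rewrite mulr_ge0// sqr_ge0.
have h4 : alpha / 2 * (2^-1 * N (w n.+1 - w 0%N) ^+ 2) <= alpha / 2 * V (w 0%N) (w n.+1).
  by rewrite ler_pM2l//; exact: (divergence_ge dgf).
have h5 : eta^-1 * (2^-1 * N (w n.+1 - w n) ^+ 2) <= eta^-1 * V (w n) (w n.+1).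
  rewrite ler_pM2l//; apply: (divergence_ge dgf) => //.
  exact: (iterate_subdifferentiable (ltnW nT)).
have h6 : dual_norm N (gam n - g (w 0%N)) * N (w n.+1 - w n) <=
    eta / 2 * dual_norm N (gam n - g (w 0%N)) ^+ 2 +
    eta^-1 * (2^-1 * N (w n.+1 - w n) ^+ 2).
  rewrite -(ler_pM2l eta_gt0) !mulrDr mulVKf ?gt_eqF//.
  have := sqr_ge0 (eta * dual_norm N (gam n - g (w 0%N)) - N (w n.+1 - w n)).
  by lra.
move: h1 h2 h3 h4 h5 h6; rewrite /eps !pairingBl !pairingBr.
by lra.
Qed.

Lemma pathwise_bound u : Z u ->
  \sum_(t < T) pairing (eps t) (s t - u) <=
    eta^-1 * V (w 0%N) u + eta / 2 * \sum_(t < T) dual_norm N (eps t) ^+ 2 ->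
  \sum_(t < T) pairing (g (w t.+1)) (w t.+1 - u) - alpha * T%:R * V (w 0%N) u
    <= \sum_(t < T) excess N alpha eta g (w 0%N) (w t) (gam t) (w t - s t).
Proof.
move=> Zu ghost_le; have := partial_regret (leqnn T) Zu.
have DT := iterate_subdifferentiable (leqnn T).
have h1 := pairing_le normN (g (w T) - g (w 0%N)) (w T - u).
have h2 : dual_norm N (g (w T) - g (w 0%N)) * N (w T - u) <=
    L * N (w T - w 0%N) * N (w T - u).
  by rewrite ler_wpM2r ?is_norm_ge0// g_lip//; case: DT.
have h3 : L * N (w T - w 0%N) * N (w T - u) <=
    alpha / 20 * N (w T - w 0%N) ^+ 2 + eta^-1 * (2^-1 * N (w T - u) ^+ 2).
  rewrite -(ler_pM2l eta_gt0) !mulrDr mulVKf ?gt_eqF//.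
  have -> : alpha / 20 = eta * L ^+ 2 / 2 by rewrite etaL; lra.
  have := sqr_ge0 (eta * L * N (w T - w 0%N) - N (w T - u)).
  by lra.
have h4 : eta^-1 * (2^-1 * N (w T - u) ^+ 2) <= eta^-1 * V (w T) u.
  by rewrite ler_pM2l ?invr_gt0// (is_norm_distC normN); exact: (divergence_ge dgf).
(* One [eta^-1 * V] comes from the mirror steps and one from the ghost iterates; the lower bound on
   [T] fits them into half of the regularization. *)
have h5 : 2 * eta^-1 * V (w 0%N) u <= alpha / 2 * T%:R * V (w 0%N) u.
  apply: ler_wpM2r.
    by apply: le_trans (divergence_ge dgf Dw0 Zu); rewrite mulr_ge0// sqr_ge0.
  have := T_ge; rewrite ler_pdivrMr ?mulr_gt0// => h.
  by rewrite -(ler_pM2l eta_gt0) mulrCA mulfV ?gt_eqF//; lra.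
have h6 : 0 <= alpha * N (w T - w 0%N) ^+ 2 by rewrite mulr_ge0 ?sqr_ge0// ltW.
have -> : \sum_(t < T) excess N alpha eta g (w 0%N) (w t) (gam t) (w t - s t) =
    - (alpha / 4) * (\sum_(t < T) N (w t - w 0%N) ^+ 2)
   + eta / 2 * (\sum_(t < T) dual_norm N (gam t - g (w 0%N)) ^+ 2
     + \sum_(t < T) dual_norm N (eps t) ^+ 2)
   + (\sum_(t < T) pairing (eps t) (w t - u) - \sum_(t < T) pairing (eps t) (s t - u)).
  rewrite -sumrB -big_split /= !mulr_sumr -!big_split /=; apply: eq_bigr => t _.
  by rewrite /excess !pairingBr; lra.
by move: ghost_le; lra.
Qed.

End pathwise_bound.
End mirror_descent.

(** * Integration against a fresh sample *)

Section integral_monotone.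
Local Open Scope ereal_scope.

(* The integral of an arbitrary function is a difference of suprema over simple
   functions, hence monotone even without measurability. *)
Lemma integral_le {d0 : measure_display} {T : measurableType d0} {R : realType}
    (m : {measure set T -> \bar R}) (f h : T -> \bar R) :
  (forall x, f x <= h x) -> \int[m]_x f x <= \int[m]_x h x.
Proof.
move=> fh; rewrite /integral !patch_setT; apply: leeB.
  apply: le_ereal_sup => _ [p pf <-]; exists p => // x.
  by rewrite (le_trans (pf x))// !funeposE ge_max !le_max fh lexx orbT.
apply: le_ereal_sup => _ [p pf <-]; exists p => // x.
by rewrite (le_trans (pf x))// !funenegE ge_max !le_max leeN2 fh lexx orbT.
Qed.

End integral_monotone.

Section freezing.
Local Open Scope ereal_scope.
Context {R : realType} {dO dS : measure_display}.
Context {Omega : measurableType dO} {S : measurableType dS}.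
Variables (P : probability Omega R) (mu : probability S R).
Variables (G : set (set Omega)) (xi : Omega -> S).
Hypotheses (GI : setI_closed G) (GT : G setT).
Hypotheses (mG : forall A, G A -> measurable A) (mxi : measurable_fun setT xi).
Hypothesis indep : forall A B, G A -> measurable B ->
  P (A `&` xi @^-1` B) = P A * mu B.

Local Notation H := (g_sigma_algebraType G).

(** The identity into [Omega] with the coarser sigma-algebra acts as a random variable carrying the
    whole past. *)
Lemma measurable_id_sub : measurable_fun setT (id : Omega -> H).
Proof.
move=> _ A mA; rewrite setTI; move: A mA.
by apply: smallest_sub; [exact: sigma_algebra_measurable|exact: mG].
Qed.

Let mid := isMeasurableFun.Build _ _ _ _ (id : Omega -> H) measurable_id_sub.
Let idH : {RV P >-> H} := MeasurableFun.Pack (MeasurableFun.Class mid).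

Let joint_measurable : measurable_fun setT ((fun omega => (omega, xi omega)) : Omega -> H * S).
Proof. by apply: measurable_fun_pair => //; exact: measurable_id_sub. Qed.

Let mjoint := isMeasurableFun.Build _ _ _ _ _ joint_measurable.
Let joint : {RV P >-> (H * S)%type} := MeasurableFun.Pack (MeasurableFun.Class mjoint).

(** Both sides are finite measures in [A] that agree on the pi-system [G]. *)
Lemma sigma_indep (A : set H) B : measurable A -> measurable B ->
  P (A `&` xi @^-1` B) = P A * mu B.
Proof.
move=> mA mB.
have mxB : measurable (xi @^-1` B) by rewrite -[_ @^-1` _]setTI; exact: mxi.
have muB0 : (0 <= fine (mu B))%R by rewrite fine_ge0.
pose m1 : {measure set H -> \bar R} := pushforward (mrestr P mxB) idH.
pose m2 : {measure set H -> \bar R} := mscale (NngNum muB0) (distribution P idH).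
have : m1 measurable_id_sub A = m2 A.
  apply: (@measure_unique _ R H G (fun=> setT) erefl GI (fun=> GT) _
    (m1 measurable_id_sub) m2 _ _ A mA).
  - by rewrite bigcup_const.
  - move=> C GC; rewrite /m1 /m2 /= /pushforward /mrestr /mscale /=.
    by rewrite indep// fineK ?fin_num_measure// muleC.
  - move=> _; rewrite /m1 /= /pushforward /mrestr /= preimage_setT setTI.
    by rewrite (le_lt_trans (probability_le1 P mxB))// ltry.
rewrite /m1 /m2 /= /pushforward /mrestr /mscale /= => ->.
by rewrite fineK ?fin_num_measure// muleC.
Qed.

Let joint_law (A : set (H * S)) : measurable A ->
  (distribution P idH \x mu) A = distribution P joint A.
Proof.
move=> mA; apply: product_measure_unique mA => A1 A2 mA1 mA2.
exact: sigma_indep.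
Qed.

Lemma freezing_ge0 (f : H * S -> \bar R) : measurable_fun setT f ->
  (forall p, 0 <= f p) ->
  \int[P]_omega f (omega, xi omega) = \int[P]_omega \int[mu]_s f (omega, s).
Proof.
move=> mf f0.
transitivity (\int[distribution P joint]_p f p).
  by rewrite ge0_integral_distribution.
transitivity (\int[distribution P idH \x mu]_p f p).
  by apply: eq_measure_integral => A mA _; exact/esym/joint_law.
rewrite fubini_tonelli1// ge0_integral_distribution//.
  exact: measurable_fun_fubini_tonelli_F.
by move=> x; exact: integral_ge0.
Qed.

(** By independence the joint law of past and fresh sample is a product, so Fubini allows
    integrating the sample with the past held fixed. *)
Lemma freezing (f : H * S -> \bar R) : measurable_fun setT f ->
  \int[P]_omega \int[mu]_s `|f (omega, s)| < +oo ->
  P.-integrable setT (fun omega => f (omega, xi omega)) /\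
  \int[P]_omega f (omega, xi omega) = \int[P]_omega \int[mu]_s f (omega, s).
Proof.
move=> mf intf; have maf : measurable_fun setT (fun p => `|f p|) by exact: measurableT_comp.
have intj : P.-integrable setT (f \o joint).
  apply/integrableP; split; first exact: measurableT_comp.
  by rewrite (freezing_ge0 (f := fun p => `|f p|)).
split=> //.
transitivity (\int[distribution P joint]_p f p).
  by rewrite integral_distribution.
transitivity (\int[distribution P idH \x mu]_p f p).
  by apply: eq_measure_integral => A mA _; exact/esym/joint_law.
have intprod : (distribution P idH \x mu).-integrable setT f.
  apply/(integrable12ltyP _ _ mf); rewrite ge0_integral_distribution//.
    by apply: (measurable_fun_fubini_tonelli_F (abse \o f)) => //= p; exact: abse_ge0.
  by move=> x; exact: integral_ge0.
have intF := integrable_fubini_F intprod.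
have /integrableP[mF iF] := intF.
rewrite -(integral12_prod_meas1 intprod) (integral_distribution mF)//.
apply/integrableP; split.
  by apply: measurableT_comp mF _; exact: measurable_id_sub.
rewrite -(ge0_integral_distribution idH (f := fun x => `|fubini_F mu f x|))//.
exact: measurableT_comp.
Qed.

End freezing.

(** * Moments of the estimator *)

Lemma integral_probability_cst {R : realType} {d0 : measure_display}
    {T : measurableType d0} (m : probability T R) (c : R) :
  (\int[m]_x c%:E = c%:E)%E.
Proof. by rewrite integral_cst//= probability_setT mule1. Qed.

Section estimator_moments.
Local Open Scope ereal_scope.
Context {R : realType} {d : nat} {dS : measure_display} {S : measurableType dS}.
Variables (N : 'rV[R]_d -> R) (Z : set 'rV[R]_d) (g : 'rV[R]_d -> 'rV[R]_d).
Variables (mu : probability S R) (w0 : 'rV[R]_d) (L : R) (gt : 'rV[R]_d -> S -> 'rV[R]_d).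
Hypotheses (normN : is_norm N) (gtP : centered_estimator N Z g mu w0 L gt).
Hypothesis L_ge0 : (0 <= L)%R.
Implicit Types z y : 'rV[R]_d.

Lemma estimator_pairing z y : Z z ->
  mu.-integrable setT (fun s => (pairing (gt z s) y)%:E) /\
  \int[mu]_s (pairing (gt z s) y)%:E = (pairing (g z) y)%:E.
Proof.
move=> Zz.
have sumE : (fun s => (pairing (gt z s) y)%:E) =
    (fun s => \sum_(i < d) (y 0 i)%:E * (gt z s 0 i)%:E).
  apply/funext => s; rewrite /pairing -sumEFin; apply: eq_bigr => i _.
  by rewrite -EFinM mulrC.
have int_i i : mu.-integrable setT (fun s => (y 0 i)%:E * (gt z s 0 i)%:E).
  by apply: integrableZl => //; exact: (estimator_integrable gtP).
rewrite sumE; split; first by apply: integrable_sum => // i _; exact: int_i.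
rewrite integral_sum// /pairing -sumEFin; apply: eq_bigr => i _.
rewrite integralZl//; last exact: (estimator_integrable gtP).
have := estimator_unbiased gtP i Zz; rewrite unlock => ->.
by rewrite -EFinM mulrC.
Qed.

Lemma estimator_dual_norm_measurable z zeta : Z z ->
  measurable_fun setT (fun s => dual_norm N (gt z s - zeta)).
Proof.
move=> Zz.
apply: (measurableT_comp (f := dual_norm N : borel_rV R d -> R)
    (g := (fun s => gt z s - zeta)%R)).
  by apply: continuous_measurable_rV; exact: dual_norm_continuous.
apply: measurable_fun_rV => i; under eq_fun do rewrite !mxE.
apply: measurable_funB => //; apply/measurable_EFinP.
exact: measurable_int (estimator_integrable gtP i Zz).
Qed.

Lemma estimator_second_moment z (c1 c2 : R) : Z z -> (0 <= c2)%R ->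
  let f s := (c1 + c2 * dual_norm N (gt z s - g w0) ^+ 2)%R in
  mu.-integrable setT (EFin \o f) /\
  \int[mu]_s (f s)%:E <= (c1 + c2 * (L ^+ 2 * N (z - w0) ^+ 2))%:E.
Proof.
move=> Zz c20 f; pose q s := (dual_norm N (gt z s - g w0) ^+ 2)%R.
have centered : \int[mu]_s (q s)%:E <= (L ^+ 2 * N (z - w0) ^+ 2)%:E.
  by have := estimator_centered gtP Zz; rewrite unlock.
have iq : mu.-integrable setT (EFin \o q).
  apply/integrableP; split.
    apply/measurable_EFinP; apply: measurable_funX.
    exact: estimator_dual_norm_measurable.
  apply: le_lt_trans (ltry (L ^+ 2 * N (z - w0) ^+ 2)).
  rewrite (eq_integral (EFin \o q))// => s _ /=.
  by rewrite ger0_norm// sqr_ge0.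
have icq : mu.-integrable setT (fun s => c2%:E * (q s)%:E) by exact: integrableZl.
have ic : mu.-integrable setT (fun=> c1%:E) by exact: finite_measure_integrable_cst.
have fE : EFin \o f = (fun s => c1%:E + c2%:E * (q s)%:E).
  by apply/funext => s; rewrite /f /q /= EFinD EFinM.
split; first by rewrite fE; exact: integrableD.
have -> : \int[mu]_s (f s)%:E = c1%:E + \int[mu]_s (c2%:E * (q s)%:E).
  rewrite -(integral_probability_cst mu c1) -integralD//;
    by apply: eq_integral => s _; rewrite -EFinM -EFinD.
by rewrite integralZl// EFinD leeD2l// EFinM lee_wpmul2l// lee_fin.
Qed.

(** The dual norm is a supremum over directions [v], so Jensen's inequality is needed only for the
    scalar [pairing (gt z s - g w0) v]. *)
Lemma centered_lipschitz z : Z z ->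
  (dual_norm N (g z - g w0) <= L * N (z - w0))%R.
Proof.
move=> Zz; apply: dual_norm_le => // v Nv.
set lam := pairing (g z - g w0) v.
have [lam0|lam0] := leP lam 0%R.
  by rewrite (le_trans lam0)// mulr_ge0// is_norm_ge0.
have [ip Ep] := estimator_pairing v Zz.
pose f s := (0 + 1 * dual_norm N (gt z s - g w0) ^+ 2)%R.
have [_ Ef] := estimator_second_moment 0%R Zz ler01.
have ip2 : mu.-integrable setT (fun s => (2 * lam)%:E * (pairing (gt z s) v)%:E).
  exact: integrableZl.
pose c := (2 * lam * pairing (g w0) v + lam ^+ 2)%R.
have ic : mu.-integrable setT (fun=> c%:E) by exact: finite_measure_integrable_cst.
(* E x^2 >= E (2 lam x - lam^2) with x = <gt - g w0, v>, whose mean is lam *)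
have : \int[mu]_s ((2 * lam)%:E * (pairing (gt z s) v)%:E - c%:E) <=
    \int[mu]_s (f s)%:E.
  apply: integral_le => s; rewrite -EFinM -EFinB lee_fin /f add0r mul1r.
  have h1 := pairing_norm_le normN (gt z s - g w0) v.
  have h2 : (`|pairing (gt z s - g w0) v| <= dual_norm N (gt z s - g w0))%R.
    by rewrite (le_trans h1)// ler_piMr// dual_norm_ge0.
  have h3 : (pairing (gt z s - g w0) v ^+ 2 <= dual_norm N (gt z s - g w0) ^+ 2)%R.
    by rewrite -[leLHS]real_normK ?num_real// ler_sqr ?nnegrE ?dual_norm_ge0.
  have := sqr_ge0 (pairing (gt z s - g w0) v - lam).
  by move: h3; rewrite /c pairingBl; lra.
rewrite integralB// integralZl// Ep integral_probability_cst => h.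
have := le_trans h Ef; rewrite -EFinM -EFinB lee_fin add0r mul1r => h2.
have lam0' := ltW lam0; have LN0 : (0 <= L * N (z - w0))%R.
  by rewrite mulr_ge0// is_norm_ge0.
rewrite -ler_sqr ?nnegrE// exprMn (le_trans _ h2)// /c.
by rewrite /lam pairingBl; lra.
Qed.

Variables (alpha eta : R).
Hypotheses (alpha_gt0 : (0 < alpha)%R) (eta_gt0 : (0 < eta)%R).
Hypothesis etaL : (eta * L ^+ 2 = alpha / 10)%R.

Lemma dual_normB_sq_le z c : Z z ->
  (dual_norm N (g z - c) ^+ 2 <=
    2 * dual_norm N (c - g w0) ^+ 2 + 2 * (L ^+ 2 * N (z - w0) ^+ 2))%R.
Proof.
move=> Zz; have := dual_normD normN (g z - g w0) (- (c - g w0)).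
rewrite dual_normN// opprB addrA subrK => h1; have h2 := centered_lipschitz Zz.
have h3 : (dual_norm N (g z - c) <= dual_norm N (c - g w0) + L * N (z - w0))%R.
  by rewrite (le_trans h1)// addrC lerD2l.
have h4 : (0 <= dual_norm N (g z - c))%R by exact: dual_norm_ge0.
have h5 : (dual_norm N (g z - c) ^+ 2 <= (dual_norm N (c - g w0) + L * N (z - w0)) ^+ 2)%R.
  by rewrite ler_sqr// nnegrE (le_trans h4).
by have := sqr_ge0 (dual_norm N (c - g w0) - L * N (z - w0)); lra.
Qed.

(** For fixed [y] the linear term has mean zero. The noise is bounded by twice the centered square
    plus [2 * q], so the total coefficient of [N (z - w0) ^+ 2] is [- alpha / 4 + (1 + 3 / 2) *
    alpha / 10 = 0]; this is where the constant 10 in [eta] comes from. *)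
Lemma integral_excess_le0 z y : Z z ->
  \int[mu]_s (excess N alpha eta g w0 z (gt z s) y)%:E <= 0.
Proof.
move=> Zz; set q := (L ^+ 2 * N (z - w0) ^+ 2)%R.
pose c1 := (- (alpha / 4) * N (z - w0) ^+ 2 + eta * q)%R.
pose c2 := (3 * eta / 2)%R.
have c20 : (0 <= c2)%R by rewrite /c2 divr_ge0// mulr_ge0// ltW.
pose f s := (c1 + c2 * dual_norm N (gt z s - g w0) ^+ 2)%R.
have [if_ Ef] := estimator_second_moment c1 Zz c20.
have [ip Ep] := estimator_pairing y Zz.
pose c := pairing (g z) y.
have ic : mu.-integrable setT (fun=> c%:E) by exact: finite_measure_integrable_cst.
apply: (@le_trans _ _ (\int[mu]_s ((f s)%:E + (c%:E - (pairing (gt z s) y)%:E)))).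
  apply: integral_le => s; rewrite -EFinB -EFinD lee_fin.
  rewrite /excess /f /c1 /c2 /c pairingBl.
  have := dual_normB_sq_le (gt z s) Zz; rewrite -/q => h.
  have : (eta / 2 * dual_norm N (g z - gt z s) ^+ 2 <=
    eta / 2 * (2 * dual_norm N (gt z s - g w0) ^+ 2 + 2 * q))%R.
    by rewrite ler_pM2l// divr_gt0.
  by lra.
rewrite integralD//; last exact: integrableB.
rewrite integralB// Ep integral_probability_cst subee// adde0.
apply: (le_trans Ef); rewrite lee_fin -/q /c1 /c2.
have -> : (eta * q = alpha / 10 * N (z - w0) ^+ 2)%R by rewrite /q mulrA etaL.
have -> : (3 * eta / 2 * q = 3 / 2 * (alpha / 10 * N (z - w0) ^+ 2))%R.
  by rewrite -etaL /q; lra.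
by lra.
Qed.

(** A domination uniform in [z] and [y], for the integrability that [freezing] requires. Young's
    inequality on the linear term accounts for both [+ 1] and for [2^-1 * K ^+ 2]. *)
Lemma excess_norm_le (M K : R) z c y : Z z -> (N (z - w0) <= M)%R -> (N y <= K)%R ->
  (`|excess N alpha eta g w0 z c y| <=
    alpha / 4 * M ^+ 2 + (eta + 1) * (L ^+ 2 * M ^+ 2) + 2^-1 * K ^+ 2
    + (3 * eta / 2 + 1) * dual_norm N (c - g w0) ^+ 2)%R.
Proof.
move=> Zz zM yK.
have N0 := is_norm_ge0 normN (z - w0); have Ny0 := is_norm_ge0 normN y.
have h1 : (N (z - w0) ^+ 2 <= M ^+ 2)%R by rewrite ler_sqr ?nnegrE// (le_trans N0).
have h2 : (N y ^+ 2 <= K ^+ 2)%R by rewrite ler_sqr ?nnegrE// (le_trans Ny0).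
have h3 := dual_normB_sq_le c Zz.
have h4 : (L ^+ 2 * N (z - w0) ^+ 2 <= L ^+ 2 * M ^+ 2)%R by rewrite ler_wpM2l// sqr_ge0.
have h5 := pairing_norm_le normN (g z - c) y.
have h6 := sqr_ge0 (dual_norm N (g z - c) - N y).
have D0 := sqr_ge0 (dual_norm N (c - g w0)).
have e0 := sqr_ge0 (dual_norm N (g z - c)).
have h7 : (eta / 2 * dual_norm N (g z - c) ^+ 2 <=
    eta / 2 * (2 * dual_norm N (c - g w0) ^+ 2 + 2 * (L ^+ 2 * M ^+ 2)))%R.
  by rewrite ler_pM2l ?divr_gt0//; lra.
have h8 : (alpha / 4 * N (z - w0) ^+ 2 <= alpha / 4 * M ^+ 2)%R.
  by rewrite ler_pM2l// divr_gt0.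
have h9 : (0 <= alpha / 4 * N (z - w0) ^+ 2)%R by rewrite mulr_ge0 ?sqr_ge0// divr_ge0// ltW.
have h10 : (0 <= eta / 2 * dual_norm N (g z - c) ^+ 2)%R.
  by rewrite mulr_ge0 ?sqr_ge0// divr_ge0// ltW.
have h11 : (0 <= eta / 2 * dual_norm N (c - g w0) ^+ 2)%R.
  by rewrite mulr_ge0 ?sqr_ge0// divr_ge0// ltW.
rewrite /excess (le_trans (ler_normD _ _))//.
rewrite (le_trans (lerD (ler_normD _ _) h5))// mulNr normrN.
rewrite (ger0_norm h9) ger0_norm; last by lra.
by lra.
Qed.

End estimator_moments.

(** * The filtration of past samples *)

Section past_cylinders.
Local Open Scope ereal_scope.
Context {R : realType} {dO dS : measure_display}.
Context {Omega : measurableType dO} {S : measurableType dS} {T : nat}.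
Variables (P : probability Omega R) (mu : probability S R) (xi : 'I_T -> {RV P >-> S}).

(** A pi-system generating the events decided by the samples before [t]. Leaving later coordinates
    at [setT] keeps one family over all of ['I_T], as in the product rule of [iid]. *)
Definition past_cylinder (t : nat) : set (set Omega) :=
  [set B | exists2 A : 'I_T -> set S,
    (forall i, measurable (A i)) /\ (forall i : 'I_T, (t <= i)%N -> A i = setT) &
    B = \bigcap_(i in setT) (xi i @^-1` A i)].

Lemma past_cylinderI t : setI_closed (past_cylinder t).
Proof.
move=> _ _ [A1 [mA1 A1T] ->] [A2 [mA2 A2T] ->].
exists (fun i => A1 i `&` A2 i); last by rewrite -bigcapI.
split=> [i|i ti]; first exact: measurableI.
by rewrite A1T// A2T// setTI.
Qed.

Lemma past_cylinderT t : past_cylinder t setT.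
Proof.
exists (fun=> setT) => //.
by rewrite (_ : (fun i => _) = fun=> setT) ?bigcapT//; apply/funext => i; rewrite preimage_setT.
Qed.

Lemma past_cylinder_measurable t A : past_cylinder t A -> measurable A.
Proof.
move=> [B [mB _] ->]; apply: fin_bigcap_measurable => [|i _]; first exact: finite_finset.
by rewrite -[_ @^-1` _]setTI; exact: measurable_funPT.
Qed.

Lemma past_cylinder_le t t' : (t <= t')%N -> past_cylinder t `<=` past_cylinder t'.
Proof.
move=> tt' _ [A [mA AT] ->]; exists A => //; split=> // i t'i.
by apply: AT; exact: leq_trans t'i.
Qed.

Local Notation past t := (g_sigma_algebraType (past_cylinder t)).

Lemma past_measurable_le {d0 : measure_display} {U : measurableType d0} t t'
    (f : Omega -> U) : (t <= t')%N ->
  measurable_fun setT (f : past t -> U) -> measurable_fun setT (f : past t' -> U).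
Proof.
move=> tt' mf _ A mA; apply: sub_sigma_algebra2 (mf measurableT A mA).
exact: past_cylinder_le.
Qed.

Lemma past_measurable (i : 'I_T) t : (i < t)%N ->
  measurable_fun setT (xi i : past t -> S).
Proof.
move=> it _ A mA; rewrite setTI; apply: sub_sigma_algebra.
exists (fun j => if j == i then A else setT).
  split=> [j|j tj]; first by case: ifP.
  by case: eqP => // ji; move: tj; rewrite ji leqNgt it.
apply/seteqP; split=> [omega xA j _ /=|omega /(_ i I) /=]; last by rewrite eqxx.
by case: eqP => [->|].
Qed.

Hypothesis iid_xi : iid mu xi.

(** The free factor at [t] can be replaced by [B], and the two product rules are then compared
    factor by factor. *)
Lemma past_indep (t : 'I_T) A B : past_cylinder t A -> measurable B ->
  P (A `&` xi t @^-1` B) = P A * mu B.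
Proof.
move=> [C [mC CT] ->] mB; have [law prod] := iid_xi.
pose C' i := if i == t then B else C i.
have mC' i : measurable (C' i) by rewrite /C'; case: ifP.
have -> : \bigcap_(i in setT) xi i @^-1` C i `&` xi t @^-1` B =
    \bigcap_(i in setT) xi i @^-1` C' i.
  apply/seteqP; split=> [omega [xC xB] i _ /=|omega xC].
    by rewrite /C'; case: eqP => [->//|_]; exact: (xC i I).
  split; last by have := xC t I; rewrite /= /C' eqxx.
  move=> i _ /=; have := xC i I; rewrite /= /C'; case: eqP => // -> _.
  by rewrite CT.
rewrite !prod// (bigD1 t)//= [in RHS](bigD1 t)//= {1}/C' eqxx law//.
rewrite CT// preimage_setT probability_setT mul1e muleC; congr (_ * _).
by apply: eq_bigr => i it; rewrite /C' (negPf it).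
Qed.

End past_cylinders.

(** * Operations on measurable row vectors *)

Section measurable_row_vectors.
Context {R : realType} {d : nat} {dT : measure_display} {T : measurableType dT}.
Implicit Types x y : T -> 'rV[R]_d.
Local Notation B := (borel_rV R d).

Lemma measurable_coord x i : measurable_fun setT (x : T -> B) ->
  measurable_fun setT (fun t => x t 0 i).
Proof. by move=> mx; exact: measurableT_comp (coord_measurable_rV i) mx. Qed.

Lemma measurable_rVB x y : measurable_fun setT (x : T -> B) ->
  measurable_fun setT (y : T -> B) -> measurable_fun setT ((fun t => x t - y t) : T -> B).
Proof.
move=> mx my; apply: measurable_fun_rV => i; under eq_fun do rewrite !mxE.
by apply: measurable_funB; exact: measurable_coord.
Qed.

Lemma measurable_pairing x y : measurable_fun setT (x : T -> B) ->
  measurable_fun setT (y : T -> B) -> measurable_fun setT (fun t => pairing (x t) (y t)).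
Proof.
move=> mx my; apply: measurable_sum => i.
by apply: measurable_funM; exact: measurable_coord.
Qed.

Lemma measurable_rV_comp (f : 'rV[R]_d -> R) x : continuous f ->
  measurable_fun setT (x : T -> B) -> measurable_fun setT (fun t => f (x t)).
Proof. by move=> /continuous_measurable_rV cf mx; exact: measurableT_comp cf mx. Qed.

End measurable_row_vectors.

(** * Expected gap *)

Section stochastic_mirror_descent.
Context {R : realType} {d T : nat} {dS dO : measure_display}.
Context {S : measurableType dS} {Omega : measurableType dO}.
Variables (Z : set 'rV[R]_d) (N r : 'rV[R]_d -> R) (alpha L eta : R).
Variables (w0 : 'rV[R]_d) (g : 'rV[R]_d -> 'rV[R]_d) (mu : probability S R).
Variables (gt : 'rV[R]_d -> S -> 'rV[R]_d) (P : probability Omega R).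
Variables (xi : 'I_T -> {RV P >-> S}) (w : nat -> Omega -> 'rV[R]_d).
Hypotheses (compZ : compact Z) (normN : is_norm N) (dgf : distance_generating Z r N).
Hypotheses (alpha_gt0 : 0 < alpha) (eta_gt0 : 0 < eta) (L_ge0 : 0 <= L).
Hypothesis etaL : eta * L ^+ 2 = alpha / 10.
Hypothesis T_ge : 4 / (eta * alpha) <= T%:R.
Hypothesis Dw0 : subdifferentiable Z r w0.
Hypotheses (contg : {within Z, continuous g}) (gtP : centered_estimator N Z g mu w0 L gt).
Hypothesis iid_xi : iid mu xi.
Hypothesis w_0 : forall omega, w 0%N omega = w0.
Hypothesis w_S : forall (t : 'I_T) omega,
  argmin Z (fun v => (pairing (gt (w t omega) (xi t omega)) v)%:E
    + (alpha / 2)%:E * bregman Z r w0 v + (eta^-1)%:E * bregman Z r (w t omega) v)%E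
    (w t.+1 omega).

Local Notation B := (borel_rV R d).
Local Notation past t := (g_sigma_algebraType (past_cylinder xi t)).
Local Notation grad := (max_subgradient Z r).

(** Extends the estimates by 0 from time [T] on, so that the pathwise bounds apply to sequences
    indexed by [nat]. *)
Let gam t omega := if insub t is Some i then gt (w t omega) (xi i omega) else 0.
Let eps omega t := g (w t omega) - gam t omega.
Let s t omega := ghost Z r eta w0 (eps omega) t.

Let gamE (t : 'I_T) omega : gam t omega = gt (w t omega) (xi t omega).
Proof. by rewrite /gam valK. Qed.

Let a_gt0 : 0 < alpha / 2. Proof. by rewrite divr_gt0. Qed.
Let b_gt0 : 0 < eta^-1. Proof. by rewrite invr_gt0. Qed.
Let Zw0 : Z w0. Proof. by case: Dw0. Qed.
Let Z0 : Z !=set0. Proof. by exists w0. Qed.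

Let w_sub t omega : (t <= T)%N -> subdifferentiable Z r (w t omega).
Proof.
elim: t => [|t IHt] tT; first by rewrite w_0.
have := w_S (Ordinal tT) omega.
move=> /(argmin_linear_min dgf a_gt0 b_gt0 Dw0 (IHt (ltnW tT))).
exact: linear_min_subdifferentiable.
Qed.

Let w_Z t omega : (t <= T)%N -> Z (w t omega).
Proof. by move=> tT; case: (w_sub omega tT). Qed.

Let w_lin t omega : (t < T)%N -> linear_min Z r ((alpha / 2 + eta^-1)^-1 *:
  (gam t omega - (alpha / 2) *: grad w0 - eta^-1 *: grad (w t omega))) (w t.+1 omega).
Proof.
move=> tT; rewrite (gamE (Ordinal tT)).
apply: (argmin_linear_min dgf a_gt0 b_gt0 Dw0 (w_sub omega (ltnW tT))).
exact: (w_S (Ordinal tT)).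
Qed.

Let mZ : measurable (Z : set B). Proof. exact: compact_measurable_rV. Qed.

Lemma estimator_comp_measurable {dU : measure_display} {U : measurableType dU}
    (z : U -> 'rV[R]_d) (x : U -> S) : (forall u, Z (z u)) ->
  measurable_fun setT (z : U -> B) -> measurable_fun setT x ->
  measurable_fun setT ((fun u => gt (z u) (x u)) : U -> B).
Proof.
move=> Zz mz mx; apply: measurable_fun_rV => i.
have mD : measurable [set p : B * S | Z p.1].
  rewrite (_ : [set p | _] = Z `*` setT); first exact: measurableX.
  by apply/seteqP; split=> -[p1 p2] //= [].
apply: (measurable_comp mD _ (estimator_measurable gtP i) (measurable_fun_pair mz mx)).
by move=> _ [u _ <-] /=.
Qed.

Lemma operator_comp_measurable {dU : measure_display} {U : measurableType dU}
    (z : U -> 'rV[R]_d) : (forall u, Z (z u)) ->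
  measurable_fun setT (z : U -> B) -> measurable_fun setT ((fun u => g (z u)) : U -> B).
Proof.
move=> Zz mz; apply: measurable_fun_rV => i.
have cgi : {within Z, continuous (fun x => g x 0 i)}.
  move=> x; apply: (@cvg_comp _ _ _ g (fun y : 'rV[R]_d => y 0 i) _ (nbhs (g x))).
    exact: contg.
  exact: coord_continuous.
apply: (measurable_comp mZ _ (within_continuous_measurable_rV mZ cgi) mz).
by move=> _ [u _ <-] /=.
Qed.

Let gam_measurable t : (t < T)%N -> measurable_fun setT (w t : past t -> B) ->
  measurable_fun setT (gam t : past t.+1 -> B).
Proof.
move=> tT mw; rewrite (_ : gam t = fun omega =>
    gt (w t omega) (xi (Ordinal tT) omega)); last first.
  by apply/funext => omega; rewrite (gamE (Ordinal tT)).
apply: estimator_comp_measurable.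
- by move=> omega; exact/w_Z/ltnW.
- exact: past_measurable_le mw.
- exact: past_measurable.
Qed.

(** By induction on [t]. The subgradient at [w t] is known to be measurable only along directions of
    [Z], which is all that [linear_min_measurable] asks for. *)
Let w_measurable t : (t <= T)%N -> measurable_fun setT (w t : past t -> B).
Proof.
elim: t => [|t IHt] tT.
  rewrite (_ : w 0%N = cst w0); first exact: measurable_cst.
  by apply/funext => omega; rewrite w_0.
have mw := IHt (ltnW tT).
apply: (@linear_min_measurable _ _ Z N r normN dgf compZ _ (past t.+1) w0 _ _ Zw0 _
  (fun omega => w_lin omega tT)) => u Zu.
under eq_fun do rewrite pairingZl 2!pairingBl !pairingZl.
apply: measurable_funM => //; apply: measurable_funB; last first.
  apply: measurable_funM => //.
  apply: (max_subgradient_measurable dgf compZ) => //.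
    exact: past_measurable_le mw.
  by move=> omega; exact/w_sub/ltnW.
apply: measurable_funB => //.
by apply: measurable_pairing => //; exact: gam_measurable.
Qed.

Let eps_measurable t : (t < T)%N ->
  measurable_fun setT ((fun omega => eps omega t) : past t.+1 -> B).
Proof.
move=> tT; have mw := w_measurable (ltnW tT).
apply: measurable_rVB; last exact: gam_measurable.
apply: operator_comp_measurable; first by move=> omega; exact/w_Z/ltnW.
exact: past_measurable_le mw.
Qed.

Let s_measurable t : (t <= T)%N -> measurable_fun setT (s t : past t -> B).
Proof.
move=> tT; apply: (measurableT_comp (f := mirror_map Z r : B -> B)).
  by apply: continuous_measurable_rV_rV; exact: mirror_map_continuous normN dgf compZ Z0.
apply: measurable_rVB => //; apply: measurable_fun_rV => i.
under eq_fun do rewrite mxE summxE.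
apply: measurable_funM => //; apply: measurable_sum => k.
apply: measurable_coord; have kT := leq_trans (ltn_ord k) tT.
exact: past_measurable_le (eps_measurable kT).
Qed.

Let excess_measurable (t : 'I_T) : measurable_fun setT
  ((fun p => excess N alpha eta g w0 (w t p.1) (gt (w t p.1) p.2) (w t p.1 - s t p.1))
    : past t * S -> R).
Proof.
have tT := ltnW (ltn_ord t).
have mw : measurable_fun setT ((fun p => w t p.1) : past t * S -> B).
  by apply: (measurableT_comp (f := w t : past t -> B)) => //; exact: w_measurable.
have ms : measurable_fun setT ((fun p => s t p.1) : past t * S -> B).
  by apply: (measurableT_comp (f := s t : past t -> B)) => //; exact: s_measurable.
have mgt : measurable_fun setT ((fun p => gt (w t p.1) p.2) : past t * S -> B).
  by apply: estimator_comp_measurable => // p; exact: w_Z.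
have mg : measurable_fun setT ((fun p => g (w t p.1)) : past t * S -> B).
  by apply: operator_comp_measurable => // p; exact: w_Z.
have cN := is_norm_continuous normN; have cD := dual_norm_continuous normN.
apply: measurable_funD; [apply: measurable_funD|].
- apply: measurable_funM => //; apply: measurable_funX.
  by apply: (measurable_rV_comp cN); exact: measurable_rVB.
- apply: measurable_funM => //; apply: measurable_funD; apply: measurable_funX.
    by apply: (measurable_rV_comp cD); exact: measurable_rVB.
  by apply: (measurable_rV_comp cD); exact: measurable_rVB.
- by apply: measurable_pairing; exact: measurable_rVB.
Qed.

(** [w t] and [s t] are functions of the past, so they are frozen while the sample of time [t] is
    integrated out. *)
Let excess_expectation (t : 'I_T) :
  let k omega := excess N alpha eta g w0 (w t omega) (gt (w t omega) (xi t omega))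
    (w t omega - s t omega) in
  P.-integrable setT (EFin \o k) /\ (\int[P]_omega (k omega)%:E <= 0)%E.
Proof.
move=> k; have tT := ltnW (ltn_ord t).
pose f (p : past t * S) : \bar R := (excess N alpha eta g w0
  (w t p.1) (gt (w t p.1) p.2) (w t p.1 - s t p.1))%:E.
have mf : measurable_fun setT f by apply/measurable_EFinP; exact: excess_measurable.
(* A farthest point of [Z] from [w0] gives the uniform bounds [M] and [K]. *)
have [M0 _ maxM] : exists2 c, c \in Z & forall z, z \in Z -> N (z - w0) <= N (c - w0).
  apply: compact_EVT_max => //; apply: continuous_subspaceT => z.
  have : {for z, continuous (N \o (fun x => x - w0))} by
    apply: continuous_comp; [apply: continuousB; [exact: cvg_id|exact: cst_continuous]|
      exact: is_norm_continuous].
  exact.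
pose M := N (M0 - w0).
have NM z : Z z -> N (z - w0) <= M by move=> Zz; exact/maxM/mem_set.
have Zs omega : Z (s t omega) by case: (mirror_mapP dgf compZ Z0
  (eta *: \sum_(i < t) eps omega i - grad w0)).
pose K := M + M.
have NK omega : N (w t omega - s t omega) <= K.
  rewrite -(subrK w0 (w t omega)) -addrA (le_trans (norm_triangle normN _ _))//.
  by rewrite (is_norm_distC normN w0) lerD// NM//; exact: w_Z.
pose c1 := alpha / 4 * M ^+ 2 + (eta + 1) * (L ^+ 2 * M ^+ 2) + 2^-1 * K ^+ 2.
pose c2 := 3 * eta / 2 + 1.
have c20 : 0 <= c2 by rewrite /c2 addr_ge0// divr_ge0// mulr_ge0// ltW.
have fle omega : (\int[mu]_x `|f (omega, x)| <= (c1 + c2 * (L ^+ 2 * M ^+ 2))%:E)%E.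
  have Zw : Z (w t omega) by exact: w_Z.
  have [_ Ec] := estimator_second_moment normN gtP c1 Zw c20.
  apply: (@le_trans _ _ (\int[mu]_x (c1 + c2 *
      dual_norm N (gt (w t omega) x - g w0) ^+ 2)%:E)%E).
    apply: integral_le => x; rewrite /f /= lee_fin.
    by apply: (excess_norm_le normN gtP L_ge0 alpha_gt0 eta_gt0) => //; exact: NM.
  apply: (le_trans Ec); rewrite lee_fin lerD2l ler_wpM2l// ler_wpM2l ?sqr_ge0//.
  by rewrite ler_sqr ?nnegrE ?is_norm_ge0// NM.
have intk : (\int[P]_omega \int[mu]_x `|f (omega, x)| < +oo)%E.
  by rewrite (le_lt_trans (integral_le P fle))// integral_probability_cst ltry.
have [intf Ef] := freezing (@past_cylinderI _ _ _ _ _ _ P xi t) (past_cylinderT xi t)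
  (@past_cylinder_measurable _ _ _ _ _ _ P xi t) (measurable_funPT (xi t))
  (fun A B => past_indep iid_xi (t := t) (A := A) (B := B)) mf intk.
split; first exact: intf.
have -> : (\int[P]_omega (k omega)%:E = \int[P]_omega \int[mu]_x f (omega, x))%E by [].
rewrite -[leRHS](integral_probability_cst P 0); apply: integral_le => omega.
have h := integral_excess_le0 normN gtP L_ge0 eta_gt0 etaL (w t omega - s t omega)
  (w_Z omega tT).
by rewrite /f /= (le_trans h).
Qed.

Lemma expected_gap_le0 :
  (\int[P]_omega ereal_sup
    [set (T%:R^-1 * \sum_(1 <= t < T.+1)
            pairing (g (w t omega)) (w t omega - u))%:E
         - alpha%:E * bregman Z r w0 u | u in Z] <= 0)%E.
Proof.
pose k (t : 'I_T) omega := excess N alpha eta g w0 (w t omega)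
  (gt (w t omega) (xi t omega)) (w t omega - s t omega).
have T_gt0 : 0 < T%:R :> R.
  by rewrite (lt_le_trans _ T_ge)// divr_gt0// mulr_gt0.
have int_sum : P.-integrable setT (fun omega => \sum_(t < T) (k t omega)%:E)%E.
  by apply: integrable_sum => // t _; have [] := excess_expectation t.
(* The pathwise bound is free of [u], so it controls the supremum; [integral_le] spares proving that
   supremum measurable. *)
apply: (@le_trans _ _ (\int[P]_omega (T%:R^-1%:E * \sum_(t < T) (k t omega)%:E))%E).
  apply: integral_le => omega; apply: ge_ereal_sup => _ [u Zu <-].
  rewrite (bregmanE dgf)// sumEFin -!EFinM -EFinB lee_fin.
  rewrite big_add1 /= big_mkord -(ler_pM2l T_gt0) mulrBr !mulVKf ?gt_eqF//.
  rewrite mulrA [T%:R * alpha]mulrC.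
  have := @pathwise_bound _ _ Z N r normN dgf alpha L eta T g (w^~ omega)
    (gam^~ omega) (s^~ omega) alpha_gt0 eta_gt0 etaL T_ge.
  rewrite w_0 => /(_ Dw0 (fun z => centered_lipschitz normN gtP L_ge0 (z := z))).
  move=> /(_ (fun t tT => w_lin omega tT) u Zu).
  have := ghost_regret normN dgf compZ Z0 (eps omega) Dw0 T eta_gt0 Zu.
  move=> /[swap] /[apply].
  move=> bound; apply: (le_trans bound).
  by apply: ler_sum => t _; rewrite gamE.
rewrite integralZl// pmule_rle0 ?lte_fin ?invr_gt0// integral_sum//; last first.
  by move=> t; have [] := excess_expectation t.
by apply: sume_le0 => t _; have [] := excess_expectation t.
Qed.

End stochastic_mirror_descent.

(** * The product domain and the conclusion *)

Lemma row_mx_continuous {R : realType} {n m : nat} :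
  continuous (fun p : 'rV[R]_n * 'rV[R]_m => row_mx p.1 p.2).
Proof.
move=> p; apply/(@cvg_ballP _ _ _ (nbhs p)) => e e0.
exists (ball p.1 e, ball p.2 e) => /=; first by split; exact: nbhsx_ballx.
move=> -[x y] /= [[_ px] [_ py]]; split=> // i j; rewrite !mxE.
by case: splitP => k _; [exact: px|exact: py].
Qed.

Local Open Scope ereal_scope.

Theorem proposition2 (R : realType) (n m : nat)
  (X : set 'rV[R]_n) (Y : set 'rV[R]_m)
  (convX : convex_set (X : set (convex_lmodType 'rV[R]_n))) (compX : compact X)
  (convY : convex_set (Y : set (convex_lmodType 'rV[R]_m))) (compY : compact Y)
  (Z : set 'rV[R]_(n + m)) (ZE : Z = [set row_mx x y | x in X & y in Y])
  (N : 'rV[R]_(n + m) -> R) (normN : is_norm N)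
  (r : 'rV[R]_(n + m) -> R) (dgf : distance_generating Z r N)
  (alpha L : R) (alpha_gt0 : (0 < alpha)%R) (L_gt0 : (0 < L)%R)
  (w0 : 'rV[R]_(n + m)) (Zw0 : Z w0)
  (g : 'rV[R]_(n + m) -> 'rV[R]_(n + m))
  (contg : {within Z, continuous g}) (mong : monotone_operator Z g)
  (dS : measure_display) (S : measurableType dS) (mu : probability S R)
  (gt : 'rV[R]_(n + m) -> S -> 'rV[R]_(n + m))
  (gtP : centered_estimator N Z g mu w0 L gt)
  (eta : R) (etaE : eta = (alpha / (10 * L ^+ 2))%R)
  (T : nat) (T_ge : (4 / (eta * alpha) <= T%:R)%R)
  (dO : measure_display) (Omega : measurableType dO) (P : probability Omega R)
  (xi : 'I_T -> {RV P >-> S}) (iid_xi : iid mu xi)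
  (w : nat -> Omega -> 'rV[R]_(n + m))
  (w_0 : forall omega, w 0%N omega = w0)
  (w_S : forall (t : 'I_T) omega,
     argmin Z (fun v =>
         (pairing (gt (w t omega) (xi t omega)) v)%:E
         + (alpha / 2)%:E * bregman Z r w0 v
         + (eta^-1)%:E * bregman Z r (w t omega) v)
       (w t.+1 omega)) :
  \int[P]_omega ereal_sup
    [set (T%:R^-1 * \sum_(1 <= t < T.+1)
            pairing (g (w t omega)) (w t omega - u))%:E
         - alpha%:E * bregman Z r w0 u | u in Z] <= 0.

Proof.
have compZ : compact Z.
  rewrite ZE (_ : [set row_mx x y | x in X & y in Y] =
    (fun p => row_mx p.1 p.2) @` (X `*` Y)).
    apply: continuous_compact; last exact: compact_setX.
    by apply: continuous_subspaceT; exact: row_mx_continuous.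
  apply/seteqP; split=> [_ [x Xx [y Yy <-]]|_ [[x y] [/= Xx Yy] <-]].
    by exists (x, y).
  by exists x => //; exists y.
have eta_gt0 : (0 < eta)%R by rewrite etaE divr_gt0// mulr_gt0// exprn_gt0.
have etaL : (eta * L ^+ 2 = alpha / 10)%R.
  by rewrite etaE; field; rewrite gt_eqF.
(* If [r] has no subgradient at [w0], the divergence from [w0] is [+oo] for every [u], and the
   bracket is [-oo]. *)
have [Dw0|nDw0] := pselect (subdiff Z r w0 !=set0).
  by apply: (expected_gap_le0 compZ normN dgf alpha_gt0 eta_gt0 (ltW L_gt0) etaL T_ge
    _ contg gtP iid_xi w_0 w_S); split.
rewrite -[leRHS](integral_probability_cst P 0); apply: integral_le => omega.
apply: ge_ereal_sup => _ [u Zu <-].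
by rewrite bregman_nondifferentiable// gt0_muley ?lte_fin//= addeNy leNye.
Qed.
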